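(* Let $\Gamma$ be a finitely generated group. (i) If $\Gamma$ is sofic and has Kazhdan's Property (T), then $\Gamma$ is not $\mathcal{P}$-stable, unless it is finite. (ii) If $\Gamma$ is hyperlinear and has Kazhdan's Property (T), then $\Gamma$ is not $\mathrm{HS}$-stable, unless it is finite.
   Context: Metrics. On $\mathrm{Sym}(n)$ let $d_n^{\mathrm{Hamming}}(\sigma,\tau)=\frac1n|\{x\in\{1,\dots,n\} : \sigma(x)\neq\tau(x)\}|$. On the unitary group $\mathrm{U}(n)$ let $d_n^{\mathrm{HS}}(A,B)=\|A-B\|_{\mathrm{HS}}$, where $\|T\|_{\mathrm{HS}}=\left(\frac1n\mathrm{Tr}(T^*T)\right)^{1/2}$. Put $\mathcal{P}=\{(\mathrm{Sym}(n),d_n^{\mathrm{Hamming}})\}_{n\ge1}$ and $\mathrm{HS}=\{(\mathrm{U}(n),d_n^{\mathrm{HS}})\}_{n\ge1}$. Stability. Let $\mathcal{G}=\{(G_n,d_n)\}_{n\ge1}$ be a family of groups with bi-invariant metrics. Let $\mathbb{F}$ be the free group on a finite set $S$ and $\pi:\mathbb{F}\to\Gamma$ a surjective homomorphism. For a function $f:S\to G$ into a group $G$ and $w\in\mathbb{F}$, $f(w)\in G$ denotes the result of substituting $s\mapsto f(s)$ in $w$. A $\mathcal{G}$-stability-challenge for $\Gamma$ is a sequence of functions $f_k:S\to G_{n_k}$, $n_k\in\mathbb{N}$, such that $d_{n_k}(f_k(w),1)\to0$ as $k\to\infty$ for every $w\in\ker\pi$. A solution for it is a sequence of functions $g_k:S\to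 G_{n_k}$ such that $g_k(w)=1$ for every $w\in\ker\pi$ and every $k$ (i.e. $g_k$ defines a homomorphism $\Gamma\to G_{n_k}$), and $\sum_{s\in S}d_{n_k}(f_k(s),g_k(s))\to0$. The group $\Gamma$ is $\mathcal{G}$-stable if every $\mathcal{G}$-stability-challenge for $\Gamma$ has a solution; this does not depend on the choice of $S$ and $\pi$. Approximation. $\Gamma$ is $\mathcal{G}$-approximated if there are integers $n_k$ and functions $\varphi_k:\Gamma\to G_{n_k}$ ($k\ge1$) such that $\lim_{k\to\infty}d_{n_k}(\varphi_k(gh),\varphi_k(g)\varphi_k(h))=0$ for all $g,h\in\Gamma$, and $\limsup_k d_{n_k}(\varphi_k(g),1)>0$ for all $1\ne g\in\Gamma$. Sofic means $\mathcal{P}$-approximated; hyperlinear means $\mathrm{HS}$-approximated. Property (T). For $Q\subset\Gamma$, $\kappa>0$ and a unitary representation $(\mathcal{H},\rho)$ of $\Gamma$, a nonzero $v\in\mathcal{H}$ is $(Q,\kappa)$-invariant if $\sup_{x\in Q}\|\rho(x)v-v\|<\kappa\|v\|$. $\Gamma$ has Property (T) if there are a finite $Q\subset\Gamma$ and $\kappa>0$ such that every unitary representation of $\Gamma$ containing a $(Q,\kappa)$-invariant vector contains a nonzero $\Gamma$-invariant vector. *)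

(* Defs.v *)
From HB Require Import structures.
From mathcomp Require Import all_boot all_order all_algebra all_fingroup.
From mathcomp Require Import sesquilinear spectral complex.
From mathcomp Require Import boolp classical_sets cardinality reals ereal.
From mathcomp Require Import topology normedtype sequences.

Set Implicit Arguments.
Unset Strict Implicit.
Unset Printing Implicit Defensive.

Import Order.TTheory GRing.Theory Num.Theory numFieldNormedType.Exports.

Local Open Scope classical_set_scope.
Local Open Scope ring_scope.
Local Open Scope sesquilinear_scope.

(* The free group on S is the type of reduced words over S * bool, the letter
   (s, true) standing for s and (s, false) for its inverse. *)
Section FreeGroup.
Variable S : choiceType.
Implicit Types (x y : S * bool) (u v w : seq (S * bool)).

Definition cancels x y := (x.1 == y.1) && (x.2 != y.2).

Definition reduced w := sorted (fun x y => ~~ cancels x y) w.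

Record free_group := FreeGroup { fg_word :> seq (S * bool); _ : reduced fg_word }.

HB.instance Definition _ := [isSub for fg_word].
HB.instance Definition _ := [Choice of free_group by <:].

Definition flip x := (x.1, ~~ x.2).

Definition push x w :=
  if w is y :: w' then if cancels x y then w' else x :: w else [:: x].

Definition fg_cat u v := foldr push v u.

Definition fg_rev w := rev (map flip w).

Lemma flipK : involutive flip.
Proof. by case=> s b; rewrite /flip /= negbK. Qed.

Lemma cancelsC x y : cancels x y = cancels y x.
Proof. by rewrite /cancels eq_sym (eq_sym x.2). Qed.

Lemma cancels_flip x y : cancels (flip x) (flip y) = cancels x y.
Proof. by rewrite /cancels /=; case: x.2; case: y.2. Qed.

Lemma cancelsP x y : cancels x y -> y = flip x.
Proof.
case: x y => s b [t c] /andP[/eqP /= -> bc]; rewrite /flip /=.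
by case: b c bc => [] [].
Qed.

Lemma cancels_flipl x : cancels (flip x) x.
Proof. by rewrite /cancels /= eqxx; case: x.2. Qed.

Lemma push_reduced x w : reduced w -> reduced (push x w).
Proof.
case: w => [//|y w] /= yw; case: ifP => [_|xy]; first exact: path_sorted yw.
by rewrite /= xy.
Qed.

Lemma fg_cat_reduced u v : reduced v -> reduced (fg_cat u v).
Proof. by move=> rv; elim: u => //= x u; exact: push_reduced. Qed.

Lemma push_flipK x w : reduced w -> push (flip x) (push x w) = w.
Proof.
case: w => [_|y w] /=; first by rewrite cancels_flipl.
case: ifP => [/cancelsP -> |xy] /=; last by rewrite cancels_flipl.
by case: w => [//|z w] /= /andP[/negbTE -> _].
Qed.

Lemma fg_catA u v w :
  reduced w -> fg_cat u (fg_cat v w) = fg_cat (fg_cat u v) w.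
Proof.
move=> rw; elim: u => //= x u ->.
case: (fg_cat u v) => [//|y t] /=; case: ifP => // /cancelsP ->.
by have:= push_flipK (flip x) (fg_cat_reduced t rw); rewrite flipK.
Qed.

Lemma fg_cats0 u : reduced u -> fg_cat u [::] = u.
Proof.
elim: u => [//|x u IHu] /= xu; rewrite IHu; last exact: path_sorted xu.
by case: u xu {IHu} => [//|y u] /= /andP[/negbTE -> _].
Qed.

Lemma fg_rev_reduced w : reduced w -> reduced (fg_rev w).
Proof.
rewrite /reduced /fg_rev rev_sorted sorted_map.
by apply: sub_sorted => x y /=; rewrite cancels_flip cancelsC.
Qed.

Lemma fg_revK : involutive fg_rev.
Proof.
by move=> w; rewrite /fg_rev map_rev revK -map_comp map_id_in // => x _; exact: flipK.
Qed.

Lemma fg_catVs w : reduced w -> fg_cat (fg_rev w) w = [::].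
Proof.
move=> rw; suff H v : reduced v -> fg_cat (fg_rev w) (fg_cat w v) = v.
  by rewrite -{2}(fg_cats0 rw) H.
elim: w {rw} => [//|x w IHw] rv.
rewrite /fg_rev /= rev_cons -cats1 /fg_cat foldr_cat /= -/(fg_cat _ _).
by rewrite push_flipK ?IHw//; exact: fg_cat_reduced.
Qed.

Definition fg_one := @FreeGroup [::] isT.
Definition fg_mul (u v : free_group) :=
  FreeGroup (fg_cat_reduced u (valP v)).
Definition fg_inv (u : free_group) := FreeGroup (fg_rev_reduced (valP u)).

Fact fg_mulA : associative fg_mul.
Proof. by move=> u v w; apply: val_inj; apply: fg_catA; exact: valP w. Qed.

Fact fg_mul1 : left_id fg_one fg_mul.
Proof. by move=> u; apply: val_inj. Qed.

Fact fg_mulr1 : right_id fg_one fg_mul.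
Proof. by move=> u; apply: val_inj; apply: fg_cats0; exact: valP u. Qed.

Fact fg_mulV : left_inverse fg_one fg_inv fg_mul.
Proof. by move=> u; apply: val_inj; apply: fg_catVs; exact: valP u. Qed.

Fact fg_mulrV : right_inverse fg_one fg_inv fg_mul.
Proof.
move=> u; apply: val_inj; rewrite /= -{1}[fg_word u]fg_revK.
by apply: fg_catVs; apply: fg_rev_reduced; exact: valP u.
Qed.

HB.instance Definition _ :=
  isGroup.Build free_group fg_mulA fg_mul1 fg_mulr1 fg_mulV fg_mulrV.

End FreeGroup.

Section Substitution.
Variables (S : choiceType) (G : groupType) (f : S -> G).

Definition subst_letter (x : S * bool) : G :=
  (if x.2 then f x.1 else (f x.1)^-1)%g.

Definition word_subst (w : free_group S) : G :=
  (\prod_(x <- fg_word w) subst_letter x)%g.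

Lemma word_subst_generator s : word_subst (@FreeGroup S [:: (s, true)] isT) = f s.
Proof. by rewrite /word_subst big_seq1. Qed.

Lemma word_substM (u v : free_group S) :
  word_subst (u * v)%g = (word_subst u * word_subst v)%g.
Proof.
rewrite /word_subst /=; elim: (fg_word u) => [|x w IHw] /=.
  by rewrite big_nil mul1g.
rewrite big_cons -mulgA -{}IHw; case: (fg_cat w v) => [|y t] /=.
  by rewrite big_seq1 big_nil mulg1.
case: ifP => [/cancelsP -> |_]; last by rewrite big_cons.
rewrite big_cons mulgA.
suff -> : (subst_letter x * subst_letter (flip x) = 1)%g by rewrite mul1g.
by case: x => s []; rewrite /subst_letter /= ?mulgV ?mulVg.
Qed.

End Substitution.

Section UnitaryGroup.
Variables (R : realType) (n : nat).

Record unitary_group :=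
  Unitary { unitary_mx :> 'M[R[i]]_n; _ : unitary_mx \is unitarymx }.

HB.instance Definition _ := [isSub for unitary_mx].
HB.instance Definition _ := [Choice of unitary_group by <:].

Fact unitary1_subproof : (1%:M : 'M[R[i]]_n) \is unitarymx.
Proof. by apply/unitarymxP; rewrite trmx1 map_mx1 mulmx1. Qed.

Fact unitaryV_subproof (A : unitary_group) : (unitary_mx A)^t* \is unitarymx.
Proof. by rewrite trmxC_unitary; exact: valP A. Qed.

Definition unitary_one := Unitary unitary1_subproof.
Definition unitary_mul (A B : unitary_group) :=
  Unitary (mul_unitarymx (valP A) (valP B)).
Definition unitary_inv (A : unitary_group) := Unitary (unitaryV_subproof A).

Fact unitary_mulA : associative unitary_mul.
Proof. by move=> A B D; apply: val_inj; exact: mulmxA. Qed.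

Fact unitary_mul1 : left_id unitary_one unitary_mul.
Proof. by move=> A; apply: val_inj; exact: mul1mx. Qed.

Fact unitary_mulr1 : right_id unitary_one unitary_mul.
Proof. by move=> A; apply: val_inj; exact: mulmx1. Qed.

Fact unitary_mulrV : right_inverse unitary_one unitary_inv unitary_mul.
Proof. by move=> A; apply: val_inj; apply/unitarymxP; exact: valP A. Qed.

Fact unitary_mulV : left_inverse unitary_one unitary_inv unitary_mul.
Proof.
by move=> A; apply: val_inj; apply: mulmx1C; apply/unitarymxP; exact: valP A.
Qed.

Lemma unitary_mxMV (A : unitary_group) :
  unitary_mx A *m (unitary_mx A)^t* = 1%:M.
Proof. by apply/unitarymxP; exact: valP A. Qed.

Lemma unitary_mxVM (A : unitary_group) :
  (unitary_mx A)^t* *m unitary_mx A = 1%:M.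
Proof. exact/mulmx1C/unitary_mxMV. Qed.

HB.instance Definition _ := isGroup.Build unitary_group
  unitary_mulA unitary_mul1 unitary_mulr1 unitary_mulV unitary_mulrV.

End UnitaryGroup.

Section MetricFamilies.
Variable R : realType.

(* The group indexed by k : nat is the one the literature calls G_(k+1), so
   that the index ranges over n >= 1. *)
Record metric_family := MetricFamily {
  fam_group :> nat -> groupType;
  fam_dist : forall n, fam_group n -> fam_group n -> R;
  fam_dist_eq0 : forall n (x y : fam_group n), fam_dist x y = 0 <-> x = y;
  fam_distC : forall n (x y : fam_group n), fam_dist x y = fam_dist y x;
  fam_dist_triangle : forall n (x y z : fam_group n),
    fam_dist x z <= fam_dist x y + fam_dist y z;
  fam_distMl : forall n (z x y : fam_group n),
    fam_dist (z * x)%g (z * y)%g = fam_dist x y;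
  fam_distMr : forall n (z x y : fam_group n),
    fam_dist (x * z)%g (y * z)%g = fam_dist x y }.

Section Hamming.
Variable n : nat.
Implicit Types s t u : 'S_n.+1.

Definition hamming_dist s t : R := #|[set x | s x != t x]%SET|%:R / n.+1%:R.

Fact hamming_dist_eq0 s t : hamming_dist s t = 0 <-> s = t.
Proof.
split=> [/eqP|->]; last first.
  rewrite /hamming_dist (_ : [set x | t x != t x]%SET = finset.set0) ?cards0 ?mul0r//.
  by apply/setP => x; rewrite !inE eqxx.
rewrite mulf_eq0 invr_eq0 !pnatr_eq0 orbF cards_eq0 => /eqP st.
apply/permP => x; have /negbT : x \in [set x | s x != t x]%SET = false.
  by rewrite st inE.
by rewrite inE negbK => /eqP.
Qed.

Fact hamming_distC s t : hamming_dist s t = hamming_dist t s.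
Proof.
by congr (_%:R / _); apply: eq_card => x; rewrite !inE eq_sym.
Qed.

Fact hamming_dist_triangle s t u :
  hamming_dist s u <= hamming_dist s t + hamming_dist t u.
Proof.
rewrite /hamming_dist -mulrDl ler_pM2r ?invr_gt0 ?ltr0n// -natrD ler_nat.
apply: leq_trans (leq_card_setU _ _); apply/subset_leq_card/fintype.subsetP => x.
by rewrite !inE; apply: contraNT; rewrite negb_or !negbK => /andP[/eqP -> /eqP ->].
Qed.

Fact hamming_distMl u s t : hamming_dist (u * s)%g (u * t)%g = hamming_dist s t.
Proof.
congr (_%:R / _); rewrite -(card_imset _ (@perm_inj _ u)).
apply: eq_card => y; apply/imsetP/idP => [[x] | ]; rewrite !inE.
  by rewrite !permM => H ->.
by move=> H; exists (u^-1 y)%g; rewrite ?inE ?permM permKV.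
Qed.

Fact hamming_distMr u s t : hamming_dist (s * u)%g (t * u)%g = hamming_dist s t.
Proof.
by congr (_%:R / _); apply: eq_card => x; rewrite !inE !permM (inj_eq perm_inj).
Qed.

End Hamming.

Section HilbertSchmidt.
Variable n : nat.
Implicit Types (T U : 'M[R[i]]_n.+1) (A B D : unitary_group R n.+1).

Definition hs_norm T : R :=
  Num.sqrt (n.+1%:R^-1 * complex.Re (\tr (T^t* *m T))).

Definition hs_dist A B : R := hs_norm (unitary_mx A - unitary_mx B).

Let dot_tr T : \tr (T^t* *m T) = dotmx (mxvec T) (mxvec T).
Proof.
rewrite mxtrace_mulC dotmxE mxE (reindex _ (curry_mxvec_bij _ _)) /=.
transitivity (\sum_i \sum_j T i j * (T i j)^*).
  apply: eq_bigr => i _; rewrite mxE; apply: eq_bigr => j _.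
  by rewrite !mxE.
by rewrite pair_bigA; apply: eq_bigr => -[i j] _; rewrite !mxE /= mxvecE.
Qed.

Let nonnegE (z : R[i]) : 0 <= z -> 0 <= complex.Re z /\ z = (complex.Re z)%:C%C.
Proof. by case: z => a b; rewrite lecE /= => /andP[/eqP ->]. Qed.

Let tr_ge0 T : 0 <= \tr (T^t* *m T).
Proof. by rewrite dot_tr dnorm_ge0. Qed.

Let hs_normE T :
  (hs_norm T)%:C%C = (Num.sqrt n.+1%:R^-1)%:C%C * sqrtC (dotmx (mxvec T) (mxvec T)).
Proof.
rewrite /hs_norm sqrtrM ?invr_ge0// rmorphM; congr (_ * _).
have [r_ge0 rE] := nonnegE (tr_ge0 T).
rewrite -dot_tr [in RHS]rE -{2}(sqr_sqrtr r_ge0) rmorphXn sqrCK//.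
by rewrite lecR sqrtr_ge0.
Qed.

Fact hs_dist_eq0 A B : hs_dist A B = 0 <-> A = B.
Proof.
split=> [/(congr1 (real_complex R))|->]; last first.
  by rewrite /hs_dist /hs_norm subrr mulmx0 mxtrace0 mulr0 sqrtr0.
rewrite hs_normE => /eqP; rewrite mulf_eq0 sqrt_dnorm_eq0 => /orP[].
  by rewrite (inj_eq (@complexI _)) sqrtr_eq0 invr_le0 lern0.
by rewrite mxvec_eq0 subr_eq0 => /eqP/val_inj.
Qed.

Fact hs_distC A B : hs_dist A B = hs_dist B A.
Proof.
rewrite /hs_dist /hs_norm -(opprB (unitary_mx B)).
congr (Num.sqrt (_ * complex.Re (\tr _))).
apply/matrixP => i j; rewrite !mxE; apply: eq_bigr => k _.
by rewrite !mxE rmorphN mulrNN.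
Qed.

Fact hs_dist_triangle A B D : hs_dist A D <= hs_dist A B + hs_dist B D.
Proof.
rewrite /hs_dist.
pose X := unitary_mx A - unitary_mx B.
pose Y := unitary_mx B - unitary_mx D.
have -> : unitary_mx A - unitary_mx D = X + Y by rewrite /X /Y subrKA.
rewrite -lecR (hs_normE (X + Y)) (linearD mxvec).
have -> := etrans (rmorphD (real_complex R) (hs_norm X) (hs_norm Y))
                  (congr2 +%R (hs_normE X) (hs_normE Y)).
rewrite -mulrDr; apply: ler_wpM2l; first by rewrite lecR sqrtr_ge0.
exact: triangle_lerif (@dotmx R[i] _) (mxvec X) (mxvec Y).
Qed.

Fact hs_distMl D A B : hs_dist (D * A)%g (D * B)%g = hs_dist A B.
Proof.
rewrite /hs_dist /= -mulmxBr; move: (unitary_mx A - unitary_mx B) => T.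
rewrite /hs_norm trmx_mul map_mxM.
by rewrite mulmxA -(mulmxA _ _ (unitary_mx D)) unitary_mxVM mulmx1.
Qed.

Fact hs_distMr D A B : hs_dist (A * D)%g (B * D)%g = hs_dist A B.
Proof.
rewrite /hs_dist /= -mulmxBl; move: (unitary_mx A - unitary_mx B) => T.
rewrite /hs_norm mxtrace_mulC trmx_mul map_mxM.
rewrite mulmxA -(mulmxA _ (unitary_mx D)) unitary_mxMV mulmx1.
by rewrite mxtrace_mulC.
Qed.

End HilbertSchmidt.

(* (s * t) x = t (s x) here; inversion is an isometric isomorphism onto the
   group with the opposite composition. *)
Definition permutation_family : metric_family :=
  MetricFamily (fam_group := fun n => 'S_n.+1 : groupType)
    hamming_dist_eq0 hamming_distC hamming_dist_triangle
    hamming_distMl hamming_distMr.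

Definition unitary_family : metric_family :=
  MetricFamily (fam_group := fun n => unitary_group R n.+1 : groupType)
    hs_dist_eq0 hs_distC hs_dist_triangle hs_distMl hs_distMr.

End MetricFamilies.

Definition finitely_generated (Gam : groupType) : Prop :=
  exists2 A : set Gam, finite_set A &
    forall H : {pred Gam}, group_closed H -> A `<=` [set` H] ->
      forall g, g \in H.

Section StabilityApproximation.
Variables (R : realType) (G : metric_family R) (Gam : groupType).

Section Challenge.
Variables (S : finType) (pi : {multiplicative free_group S -> Gam}).
Variable n : nat -> nat.
Implicit Types f g : forall k, S -> G (n k).

Definition stability_challenge f : Prop :=
  forall w, pi w = 1%g -> fam_dist (word_subst (f k) w) 1%g @[k --> \oo] --> 0.

Definition challenge_solution f g : Prop :=
  (forall k w, pi w = 1%g -> word_subst (g k) w = 1%g) /\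
  (\sum_s fam_dist (f k s) (g k s)) @[k --> \oo] --> 0.

End Challenge.

Definition stable_for (S : finType)
    (pi : {multiplicative free_group S -> Gam}) : Prop :=
  forall (n : nat -> nat) (f : forall k, S -> G (n k)),
    stability_challenge pi f -> exists g, challenge_solution pi f g.

(* Stability does not depend on the presentation; the existential form makes
   the negation say that Gam is stable for none of them. *)
Definition stable : Prop :=
  exists (S : finType) (pi : {multiplicative free_group S -> Gam}),
    (forall g, exists w, pi w = g) /\ stable_for pi.

Definition approximated : Prop :=
  exists (n : nat -> nat) (phi : forall k, Gam -> G (n k)),
    (forall g h,
       fam_dist (phi k (g * h)%g) (phi k g * phi k h)%g @[k --> \oo] --> 0) /\
    (forall g, g != 1%g ->
       (0 < limn_esup (fun k => (fam_dist (phi k g) 1%g)%:E))%E).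

End StabilityApproximation.

Definition sofic (R : realType) (Gam : groupType) : Prop :=
  approximated (permutation_family R) Gam.

Definition hyperlinear (R : realType) (Gam : groupType) : Prop :=
  approximated (unitary_family R) Gam.

Section PropertyT.
Variables (R : realType) (Gam : groupType).

(* A complex Hilbert space: a Banach space whose norm comes from an inner
   product.  The norm of a normed module over R[i] is R[i]-valued, hence the
   real part below. *)
Record hilbert_space := HilbertSpace {
  hilbert_car :> completeNormedModType R[i];
  inner : {dot hilbert_car for Num.conj};
  innerE : forall v, inner v v = `|v| ^+ 2 }.

Definition hilbert_norm (H : hilbert_space) (v : H) : R := complex.Re `|v|.

Record unitary_rep (H : hilbert_space) := UnitaryRep {
  rep_map :> Gam -> {linear H -> H};
  rep_map1 : forall v, rep_map 1%g v = v;
  rep_mapM : forall g h v, rep_map (g * h)%g v = rep_map g (rep_map h v);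
  rep_map_inner : forall g v w,
    inner H (rep_map g v) (rep_map g w) = inner H v w }.

Definition almost_invariant (H : hilbert_space) (rho : unitary_rep H)
    (Q : set Gam) (kappa : R) (v : H) : Prop :=
  sup [set hilbert_norm (rho x v - v) | x in Q] < kappa * hilbert_norm v.

Definition rep_invariant (H : hilbert_space) (rho : unitary_rep H)
    (v : H) : Prop :=
  forall g, rho g v = v.

Definition property_T : Prop :=
  exists (Q : set Gam) (kappa : R), [/\ finite_set Q, 0 < kappa &
    forall (H : hilbert_space) (rho : unitary_rep H),
      (exists2 v : H, v != 0 & almost_invariant rho Q kappa v) ->
      exists2 v : H, v != 0 & rep_invariant rho v].

End PropertyT.

(* Main.v *)
From HB Require Import structures.
Require Import Defs.
From mathcomp Require Import all_boot all_order all_algebra all_fingroup.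
From mathcomp Require Import sesquilinear spectral complex mxtens.
From mathcomp Require Import boolp classical_sets cardinality reals ereal.
From mathcomp Require Import topology normedtype sequences realfun.
From mathcomp Require Import zify ring lra.

Set Implicit Arguments.
Unset Strict Implicit.
Unset Printing Implicit Defensive.

Import Order.TTheory GRing.Theory Num.Theory numFieldNormedType.Exports.

Local Open Scope classical_set_scope.
Local Open Scope ring_scope.
Local Open Scope sesquilinear_scope.

(** Suppose that an infinite group Gam with Property (T) is stable and
    approximated with respect to one of the two families.

    Stability turns every sequence of asymptotically multiplicative maps into
    honest homomorphisms which are pointwise close to it (stable_almost_hom).
    Applied to an approximation, it shows that homomorphisms from Gam to the
    groups of the family separate the points of Gam.  As Gam is infinite, there
    are then indecomposable objects of unbounded size: transitive actions of
    Gam on finite sets in the first case (transitive_unbounded), irreducible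
    unitary representations in the second (irreducible_unbounded).

    Take such an indecomposable rho of size n + 1 and delete one point, or one
    dimension.  Repairing each rho(g) costs O(1/n) in the Hamming metric and
    O(1/sqrt n) in the Hilbert-Schmidt metric, so that asymptotically rho
    becomes a homomorphism into the group of size n; stability provides an
    actual homomorphism sigma of size n such that sigma plus a trivial summand
    is close to rho (stable_restrict).  Let Gam act on square matrices by
    T |-> rho(g)^-1 T (sigma + 1)(g).  The identity matrix is almost invariant,
    hence by Property (T) it is near a matrix T intertwining rho with sigma + 1
    (kazhdan_intertwiner).  This is absurd.  In the unitary case T is nonzero,
    thus invertible by Schur's lemma, although rho is irreducible and sigma + 1
    is not.  In the permutation case the entries of T with real part above 1/2
    form the graph of an equivariant bijection, although rho is transitive and
    sigma + 1 has a fixed point (perm_intertwiner_transitive).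

    The permutation case of the unboundedness statement is a counting argument:
    a finitely generated group has only finitely many homomorphisms to a given
    finite group.  In the unitary case Property (T) implies that there are
    finitely many irreducible representations of dimension at most D, because
    two of them which are close on a Kazhdan set have a nonzero intertwiner.
    If there were no others, then the algebra of all matrix coefficients would
    be finite-dimensional; but an algebra of functions which separates the
    points of an infinite set is infinite-dimensional.

    Property (T) is applied to finite-dimensional Hilbert spaces only.  Unitary
    representations are written as maps into unitary matrices which act on row
    vectors from the right. *)

(** * The Hilbert space of row vectors *)

(** An alias, because row vectors canonically carry the supremum norm. *)
Definition ell2 (R : realType) (d : nat) : Type := 'rV[R[i]]_d.
Section Ell2.
Variables (R : realType) (d : nat).
HB.instance Definition _ := GRing.Lmodule.copy (ell2 R d) 'rV[R[i]]_d.
Definition ell2_norm (v : ell2 R d) : R[i] := sqrtC (dotmx v v).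
Fact ell2_normD (u v : ell2 R d) : ell2_norm (u + v) <= ell2_norm u + ell2_norm v.
Proof. exact: triangle_lerif (@dotmx R[i] _) u v. Qed.
Fact ell2_normZ (c : R[i]) (v : ell2 R d) : ell2_norm (c *: v) = `|c| * ell2_norm v.
Proof. by rewrite /ell2_norm dnormZ sqrtCM ?qualifE/= ?exprn_ge0 ?dnorm_ge0 ?sqrCK. Qed.
Fact ell2_norm0_eq0 (v : ell2 R d) : ell2_norm v = 0 -> v = 0.
Proof. by move/eqP; rewrite sqrt_dnorm_eq0 => /eqP. Qed.
HB.instance Definition _ := @Lmodule_isNormed.Build R[i] (ell2 R d) _ ell2_normD
  ell2_normZ ell2_norm0_eq0.

Lemma ell2_normE (v : ell2 R d) : `|v| = sqrtC (dotmx v v). Proof. by []. Qed.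

Lemma dotmx_sum (u v : 'rV[R[i]]_d) : dotmx u v = \sum_j u 0 j * (v 0 j)^*.
Proof. by rewrite dotmxE mxE; apply: eq_bigr => j _; rewrite !mxE. Qed.

Lemma ler_coord (v : ell2 R d) j : `|v 0 j| <= `|v|.
Proof.
rewrite ell2_normE -(@sqrCK _ `|v 0 j|)// ler_sqrtC ?qualifE/= ?exprn_ge0 ?dnorm_ge0//.
rewrite dotmx_sum (bigD1 j)//= -normCK lerDl.
by apply: sumr_ge0 => i _; rewrite -normCK exprn_ge0.
Qed.

Lemma ler_norm_coord (v : ell2 R d) : `|v| <= \sum_j `|v 0 j|.
Proof.
rewrite {1}[v]row_sum_delta (le_trans (ler_norm_sum _ _ _))//.
apply: ler_sum => j _; rewrite normrZ.
suff -> : `|(delta_mx 0 j : ell2 R d)| = 1 by rewrite mulr1.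
rewrite ell2_normE dotmx_sum (bigD1 j)//= big1 => [|k kj].
  by rewrite mxE !eqxx conjC1 mulr1 addr0 sqrtC1.
by rewrite mxE (negPf kj) andbF mul0r.
Qed.

Lemma real_posE (e : R[i]) : 0 < e -> exists2 r : R, 0 < r & e = r%:C%C.
Proof. by case: e => a b; rewrite ltcE /= => /andP[/eqP -> a0]; exists a. Qed.

(** Real and imaginary parts of the entries are 1-Lipschitz, which reduces the
    completeness of ell2 to that of R, one real coordinate at a time. *)
Let cauchy_coord (F : set_system (ell2 R d)) (c : ell2 R d -> R) :
    ProperFilter F -> cauchy F ->
    (forall u v, `|c u - c v|%:C%C <= `|u - v|) ->
  exists a : R, forall r, 0 < r -> \forall x \near F, `|a - c x| < r.
Proof.
move=> FF cF Hc; have : cauchy (c @ F).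
  apply/cauchyP => r r0.
  have : cauchy_ex F by apply/cauchyP.
  case/(_ (r%:C%C)); first by rewrite ltcR.
  move=> x Hx; exists (c x) => /=.
  apply: filterS Hx => y; rewrite -!ball_normE /= => xy.
  by rewrite -ltcR (le_lt_trans (Hc _ _)).
move=> /R_complete/cvg_ex[a Ha]; exists a => r r0.
by move/cvgrPdist_lt: Ha => /(_ _ r0).
Qed.

Let normc_ge_Im (z : R[i]) : `|complex.Im z|%:C%C <= `|z|.
Proof. by rewrite normc_def lecR -sqrtr_sqr ler_wsqrtr// lerDr sqr_ge0. Qed.

Let cauchy_coordC (F : set_system (ell2 R d)) j : ProperFilter F -> cauchy F ->
  exists z : R[i], forall r : R, 0 < r -> \forall x \near F, `|z - (x : ell2 R d) 0 j|
    < r%:C%C.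
Proof.
move=> FF cF.
have [|a Ha] := @cauchy_coord F (fun v => complex.Re (v 0 j)) FF cF.
  move=> u v; rewrite -raddfB/= (le_trans (normc_ge_Re _))//.
  by have := ler_coord (u - v) j; rewrite !mxE.
have [|b Hb] := @cauchy_coord F (fun v => complex.Im (v 0 j)) FF cF.
  move=> u v; rewrite -raddfB/= (le_trans (normc_ge_Im _))//.
  by have := ler_coord (u - v) j; rewrite !mxE.
exists (a +i* b)%C => r r0; have r20 : 0 < r / 2 by rewrite divr_gt0.
near=> x.
have -> : ((a +i* b)%C - x 0 j) = (a - complex.Re (x 0 j))%:C%C + 'i * (b - complex.Im
  (x 0 j))%:C%C.
  by case: (x 0 j) => p q; apply/eqP; rewrite eq_complex /= !mul0r !mul1r ?subr0 ?add0r
    ?addr0 ?mulr0 ?subr0 ?addr0 !eqxx.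
apply: (le_lt_trans (ler_normD _ _)).
rewrite normrM normCi mul1r !normc_def /= !expr0n /= !addr0 !sqrtr_sqr.
rewrite -rmorphD/= ltcR [ltRHS]splitr ltrD//.
  by near: x; exact: Ha.
by near: x; exact: Hb.
Unshelve. all: by end_near. Qed.

Fact ell2_complete (F : set_system (ell2 R d)) : ProperFilter F -> cauchy F -> cvg F.
Proof.
move=> FF cF; have /choice[z Hz] := fun j => @cauchy_coordC F j FF cF.
apply/cvg_ex; exists (\row_j z j : ell2 R d); apply/cvgrPdist_lt => e /real_posE[r r0 ->].
have rd0 : 0 < r / d.+1%:R by rewrite divr_gt0.
have H : \forall x \near F, forall j, `|z j - (x : ell2 R d) 0 j| < (r / d.+1%:R)%:C%C.
  apply: filter_forall => j; exact: Hz.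
near=> x; apply: (le_lt_trans (ler_norm_coord _)).
apply: (@le_lt_trans _ _ (\sum_(j < d) (r / d.+1%:R)%:C%C)).
  apply: ler_sum => j _; rewrite !mxE ltW//; move: j; near: x; exact: H.
rewrite -rmorph_sum/= sumr_const card_ord ltcR -[_ *+ d]mulr_natr mulrAC ltr_pdivrMr//.
by rewrite ltr_pM2l// ltr_nat.
Unshelve. all: by end_near. Qed.

HB.instance Definition _ := @Uniform_isComplete.Build (ell2 R d) ell2_complete.

Fact ell2_innerE (v : ell2 R d) : (@dotmx R[i] d : {dot _ for _}) v v = `|v| ^+ 2.
Proof. by rewrite ell2_normE sqrtCK. Qed.
Definition ell2_hilbert : hilbert_space R := @HilbertSpace R (ell2 R d) (@dotmx R[i] d)
  ell2_innerE.
End Ell2.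

(** * Unitary matrix representations and Property (T) *)

Section UnitaryReps.
Variable R : realType.
Local Notation C := R[i].

Definition vnorm d (v : 'rV[C]_d) : R := complex.Re (sqrtC (dotmx v v)).

Lemma vnormE d (v : 'rV[C]_d) : (vnorm v)%:C%C = sqrtC (dotmx v v).
Proof. by have:= sqrt_dnorm_ge0 (@dotmx C d) v; rewrite /vnorm; case: sqrtC => a b;
  rewrite lecE /= => /andP[/eqP -> _]. Qed.

Lemma vnorm_ge0 d (v : 'rV[C]_d) : 0 <= vnorm v.
Proof. by rewrite -lecR vnormE; exact: sqrt_dnorm_ge0. Qed.

Lemma vnorm_eq0 d (v : 'rV[C]_d) : (vnorm v == 0) = (v == 0).
Proof. by rewrite -(inj_eq (@complexI _)) vnormE; exact: sqrt_dnorm_eq0. Qed.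

Lemma vnorm_gt0 d (v : 'rV[C]_d) : (0 < vnorm v) = (v != 0).
Proof. by rewrite lt_neqAle vnorm_ge0 andbT eq_sym vnorm_eq0. Qed.

Lemma vnorm0 d : vnorm (0 : 'rV[C]_d) = 0.
Proof. by apply/eqP; rewrite vnorm_eq0. Qed.

Lemma vnormN d (v : 'rV[C]_d) : vnorm (- v) = vnorm v.
Proof. by rewrite /vnorm hnormN. Qed.

Lemma vnorm_sqr d (v : 'rV[C]_d) : (vnorm v ^+ 2)%:C%C = dotmx v v.
Proof. by rewrite rmorphXn /= vnormE sqrtCK. Qed.

Lemma dotmx_unitary m n (U : 'M[C]_(m, n)) u v : U \is unitarymx ->
  dotmx (u *m U) (v *m U) = dotmx u v.
Proof.
move=> /unitarymxP UU; rewrite !dotmxE trmx_mul map_mxM.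
by rewrite mulmxA -(mulmxA u) UU mulmx1.
Qed.

Lemma vnorm_unitary m n (U : 'M[C]_(m, n)) v : U \is unitarymx ->
  vnorm (v *m U) = vnorm v.
Proof. by move=> Uu; rewrite /vnorm dotmx_unitary. Qed.

Variable Gam : groupType.

Definition unirep d (D : Gam -> 'M[C]_d) :=
  (forall g, D g \is unitarymx) /\ (forall g h, D (g * h)%g = D g *m D h).

Lemma unirep1 d (D : Gam -> 'M[C]_d) : unirep D -> D 1%g = 1%:M.
Proof.
case=> Du DM; have := DM 1%g 1%g; rewrite mulg1 => /(congr1 (mulmx (invmx (D 1%g)))).
by rewrite mulKmx ?unitarymx_unit// => <-; rewrite mulVmx ?unitarymx_unit.
Qed.

Lemma unirepV d (D : Gam -> 'M[C]_d) g : unirep D -> D g *m D g^-1%g = 1%:M.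
Proof. by move=> rD; have [_ DM] := rD; rewrite -DM mulgV unirep1. Qed.

Section ToRep.
Variables (d : nat) (D : Gam -> 'M[C]_d) (rD : unirep D).

Definition ell2_act g : {linear ell2_hilbert R d -> ell2_hilbert R d} :=
  (mulmxr (D g^-1%g) : {linear 'rV[C]_d -> 'rV[C]_d}).

Fact ell2_rep1 v : ell2_act 1%g v = v.
Proof. by rewrite /= invg1 unirep1// mulmx1. Qed.
Fact ell2_repM g h v : ell2_act (g * h)%g v = ell2_act g (ell2_act h v).
Proof. by rewrite /= invgM (proj2 rD) mulmxA. Qed.
Fact ell2_rep_inner g v w :
  inner (ell2_hilbert R d) (ell2_act g v) (ell2_act g w) = inner (ell2_hilbert R d) v w.
Proof. by apply: dotmx_unitary; case: rD. Qed.

Definition ell2_rep : unitary_rep Gam (ell2_hilbert R d) :=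
  UnitaryRep ell2_rep1 ell2_repM ell2_rep_inner.
End ToRep.

(** The part of Property (T) which the proof uses: Kazhdan's condition for
    matrix representations. *)
Definition kazhdan_pair (Q : seq Gam) (kappa : R) :=
  0 < kappa /\ forall d (D : Gam -> 'M[C]_d), unirep D -> forall v : 'rV_d, v != 0 ->
    (forall q, q \in Q -> vnorm (v *m D q - v) < kappa * vnorm v) ->
    exists2 u : 'rV_d, u != 0 & forall g, u *m D g = u.

(** A matrix representation acts on ell2 by v |-> v D(g)^-1; this displaces v as
    much as v |-> v D(g) does.  Q may be empty, in which case the supremum in the
    definition of almost invariance is 0 by convention. *)
Lemma property_T_kazhdan_pair : property_T R Gam -> exists Q kappa, kazhdan_pair Q kappa.
Proof.
case=> Q [kappa [/finite_seqP[s Qs] k0 HT]]; exists s, kappa; split=> // d D rD v v0 Hv.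
have [|u u0 Hu] := HT (ell2_hilbert R d) (ell2_rep rD); last first.
  exists u => // g; have := Hu g^-1%g; by rewrite /= invgK.
exists v => //; rewrite /almost_invariant.
set B := [set _ | _ in Q].
have : forall x, B x -> x < kappa * vnorm v.
  move=> _ [q + <-]; rewrite Qs /= => qs.
  rewrite /hilbert_norm /= -[complex.Re _]/(vnorm _).
  have -> : (v *m D q^-1%g : 'rV_d) - v = - (v *m D q - v) *m D q^-1%g.
    by rewrite mulNmx mulmxBl -mulmxA unirepV// mulmx1 opprB.
  by rewrite vnorm_unitary ?vnormN ?Hv//; exact: (proj1 rD).
move=> HB.
have Bfin : finite_set B by rewrite /B Qs; apply: finite_image; exact: finite_seq.
have [->|/set0P[x0 Bx0]] := eqVneq B set0.
  by rewrite sup0 mulr_gt0// -[hilbert_norm _]/(vnorm v) vnorm_gt0.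
have /finite_seqP[t Bt] := Bfin.
apply: (@le_lt_trans _ _ (\big[Num.max/x0]_(x <- t) x)).
  apply: ge_sup; first by exists x0.
  by move=> x; rewrite Bt /= => xt; exact: le_bigmax_seq.
rewrite -[hilbert_norm _]/(vnorm v).
rewrite big_seq; apply: bigmax_lt => [|x xt]; first exact: HB.
by apply: HB; rewrite Bt.
Qed.

End UnitaryReps.

(** * Almost fixed vectors are near fixed vectors *)

Section Closeness.
Variables (R : realType) (Gam : groupType).
Local Notation C := R[i].

(** Orthonormal bases of row spaces allow a subrepresentation to be treated as a
    matrix representation in its own right. *)
Definition orthobasis m n (A : 'M[C]_(m, n)) : 'M[C]_(\rank A, n) := schmidt (row_base A).

Lemma orthobasis_unitary m n (A : 'M[C]_(m, n)) : orthobasis A \is unitarymx.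
Proof. by apply: schmidt_unitarymx; exact: rank_leq_col. Qed.

Lemma orthobasis_eqmx m n (A : 'M[C]_(m, n)) : (orthobasis A :=: A)%MS.
Proof. by apply: eqmx_trans (eq_row_base A); apply: eqmx_schmidt_free;
  exact: row_base_free. Qed.

Lemma unitary_proj m n p (B : 'M[C]_(m, n)) (A : 'M[C]_(p, n)) : B \is unitarymx ->
  (A <= B)%MS -> A *m B^t* *m B = A.
Proof. by move=> /unitarymxP BB /submxP[X ->]; rewrite -(mulmxA X) BB mulmx1. Qed.

Definition subrep m n (B : 'M[C]_(m, n)) (D : Gam -> 'M[C]_n) g := B *m D g *m B^t*.

Section SubRep.
Variables (m n : nat) (B : 'M[C]_(m, n)) (D : Gam -> 'M[C]_n).
Hypotheses (Bu : B \is unitarymx) (rD : unirep D).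
Hypothesis stB : forall g, (B *m D g <= B)%MS.

Lemma subrepE g : subrep B D g *m B = B *m D g.
Proof. exact: unitary_proj. Qed.

Lemma subrep_unirep : unirep (subrep B D).
Proof.
split=> [g|g h]; last by rewrite /subrep (proj2 rD) !mulmxA unitary_proj.
apply/unitarymxP; rewrite /subrep !trmx_mul !map_mxM trmxCK.
rewrite !mulmxA unitary_proj// -(mulmxA B) (unitarymxP (proj1 rD g)) mulmx1.
exact/unitarymxP.
Qed.
End SubRep.

(** The fixed vectors form a subspace, represented by a matrix of maximal rank
    among those whose rows are fixed. *)
Lemma unirep_fixed_submx n (D : Gam -> 'M[C]_n) : exists W : 'M[C]_n,
  (forall g, W *m D g = W) /\
  forall u : 'rV_n, (forall g, u *m D g = u) -> (u <= W)%MS.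
Proof.
pose P r := `[< exists2 W : 'M[C]_n, (forall g, W *m D g = W) & \rank W = r >].
have PP r : reflect (exists2 W : 'M[C]_n, (forall g, W *m D g = W) & \rank W = r) (P r).
  exact: asboolP.
have exP : exists r, P r.
  by exists 0%N; apply/PP; exists 0; rewrite ?mxrank0// => g; rewrite mul0mx.
have bdP r : P r -> (r <= n)%N by case/PP=> W _ <-; exact: rank_leq_col.
case: (ex_maxnP exP bdP) => r /PP[W HW rW] max; exists W; split=> // u Hu.
have [//|/negP nuW] := boolP (u <= W)%MS.
have : P (\rank (W + u)%MS).
  apply/PP; exists (W + u)%MS => // g.
  have /sub_addsmxP[[X Y] /= ->] := submx_refl (W + u)%MS.
  by rewrite mulmxDl -!mulmxA HW Hu.
move/max; rewrite -rW => rk; case: nuW.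
have := mxrank_leqif_sup (addsmxSl W u); case=> le; rewrite eqn_leq le rk /=.
by move=> /esym; apply: submx_trans; exact: addsmxSr.
Qed.

(** Unitary matrices preserve orthogonality, and D(g) is the adjoint of
    D(g^-1). *)
Lemma orthomx_stable n (D : Gam -> 'M[C]_n) (W : 'M[C]_n) : unirep D ->
  (forall g, (W *m D g <= W)%MS) -> forall g,
  (orthomx Num.conj 1%:M W *m D g <= orthomx Num.conj 1%:M W)%MS.
Proof.
move=> rD HW g; apply/orthomx1P.
have /submxP[X HX] := HW g^-1%g.
have -> : D g = (D g^-1%g)^t*.
  rewrite -[LHS]mulmx1 -(unitarymxP (proj1 rD g^-1%g)) mulmxA unirepV//.
  by rewrite mul1mx.
have : (orthomx Num.conj 1%:M W <= orthomx Num.conj 1%:M W)%MS by [].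
move/orthomx1P => H0; rewrite -mulmxA -map_mxM -trmx_mul HX trmx_mul map_mxM mulmxA.
by rewrite H0 mul0mx.
Qed.

(** Property (T) applied to the orthogonal complement of the fixed vectors,
    which is a representation without nonzero fixed vectors: the component w of v
    in it is displaced exactly as v is, so |w| > eps would make w almost
    invariant. *)
Lemma kazhdan_near_fixed (Q : seq Gam) (kappa eps : R) n (D : Gam -> 'M[C]_n) (v : 'rV_n) :
  kazhdan_pair Q kappa -> 0 <= eps -> unirep D ->
  (forall q, q \in Q -> vnorm (v *m D q - v) < kappa * eps) ->
  exists2 u : 'rV_n, forall g, u *m D g = u & vnorm (v - u) <= eps.
Proof.
move=> [k0 HT] e0 rD Hv; have [W [HW maxW]] := unirep_fixed_submx D.
have /sub_addsmxP[[a b] /= vE] : (v <= W + orthomx Num.conj 1%:M W)%MS.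
  by rewrite addsmx_ortho submx1.
exists (a *m W) => [g|]; first by rewrite -mulmxA HW.
set w := b *m _ in vE; have -> : v - a *m W = w by rewrite vE addrAC subrr add0r.
have wW : (w <= orthomx Num.conj 1%:M W)%MS by exact: submxMl.
rewrite leNgt; apply/negP => epsw.
pose B := orthobasis (orthomx Num.conj 1%:M W).
have Bu : B \is unitarymx by exact: orthobasis_unitary.
have BW : (B :=: orthomx Num.conj 1%:M W)%MS by exact: orthobasis_eqmx.
have stB g : (B *m D g <= B)%MS.
  rewrite BW (submx_trans _ (orthomx_stable rD _ g))// => [|h]; last by rewrite HW.
  by rewrite submxMr// BW.
have wB : w *m B^t* *m B = w by rewrite unitary_proj// BW.
have wBn : vnorm (w *m B^t*) = vnorm w by rewrite -(vnorm_unitary _ Bu) wB.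
have w0 : 0 < vnorm w by exact: le_lt_trans epsw.
have [|q qQ|u u0 Hu] := HT _ _ (subrep_unirep Bu rD stB) (w *m B^t*).
- by rewrite -vnorm_gt0 wBn.
- rewrite wBn -(vnorm_unitary _ Bu) mulmxBl -mulmxA subrepE// mulmxA wB.
  have -> : w *m D q - w = v *m D q - v.
    by rewrite vE mulmxDl -(mulmxA a) HW opprD addrACA subrr add0r.
  by rewrite (lt_trans (Hv q qQ))// ltr_pM2l.
have uB g : u *m B *m D g = u *m B by rewrite -mulmxA -subrepE// mulmxA Hu.
have : (u *m B <= W :&: orthomx Num.conj 1%:M W)%MS.
  by rewrite sub_capmx maxW//= -BW submxMl.
rewrite orthomx_ortho_disj submx0 => /eqP/(congr1 (mulmx^~ (B^t*))).
rewrite -mulmxA (unitarymxP Bu) mulmx1 mul0mx => u0'.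
by rewrite u0' eqxx in u0.
Qed.
End Closeness.

(** * Intertwiners *)

Section Intertwiners.
Variables (R : realType).
Local Notation C := R[i].

Lemma dotmx_mxvecE m n (A B : 'M[C]_(m, n)) :
  dotmx (mxvec A) (mxvec B) = \tr (A *m B^t*).
Proof.
rewrite dotmxE mxE (reindex _ (curry_mxvec_bij _ _)) /=.
transitivity (\sum_i \sum_j A i j * (B i j)^*).
  by rewrite pair_bigA; apply: eq_bigr => -[i j] _; rewrite !mxE /= !mxvecE.
by apply: eq_bigr => i _; rewrite mxE; apply: eq_bigr => j _; rewrite !mxE.
Qed.

(** The Frobenius norm, which is not normalised by the dimension. *)
Definition fro m n (A : 'M[C]_(m, n)) : R := vnorm (mxvec A).

Lemma fro_ge0 m n (A : 'M[C]_(m, n)) : 0 <= fro A. Proof. exact: vnorm_ge0. Qed.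

Lemma fro0 m n : fro (0 : 'M[C]_(m, n)) = 0.
Proof. by rewrite /fro linear0 vnorm0. Qed.

Lemma fro_sqr m n (A : 'M[C]_(m, n)) : (fro A ^+ 2)%:C%C = \tr (A *m A^t*).
Proof. by rewrite vnorm_sqr dotmx_mxvecE. Qed.

Lemma fro_sqr_sum m n (A : 'M[C]_(m, n)) :
  fro A ^+ 2 = \sum_i \sum_j (complex.Re (A i j) ^+ 2 + complex.Im (A i j) ^+ 2).
Proof.
apply: complexI; rewrite fro_sqr rmorph_sum; apply: eq_bigr => i _.
rewrite mxE rmorph_sum; apply: eq_bigr => j _ /=.
by rewrite !mxE add_Re2_Im2 normCK.
Qed.

Lemma froN m n (A : 'M[C]_(m, n)) : fro (- A) = fro A.
Proof. by rewrite /fro linearN vnormN. Qed.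

Lemma froB m n (A B : 'M[C]_(m, n)) : fro (A - B) = fro (B - A).
Proof. by rewrite -froN opprB. Qed.

Lemma fro_mull m n (A : 'M[C]_(m, n)) (U : 'M[C]_m) : U \is unitarymx ->
  fro (U *m A) = fro A.
Proof.
move=> Uu; apply/eqP; rewrite -(@eqrXn2 _ 2) ?fro_ge0//.
apply/eqP/complexI; rewrite !fro_sqr trmx_mul map_mxM mxtrace_mulC -!mulmxA.
by rewrite (mulmxA (U^t*)) mulmx1C ?mul1mx 1?mxtrace_mulC//; apply/unitarymxP.
Qed.

Lemma fro_sqr1 n : fro (1%:M : 'M[C]_n) ^+ 2 = n%:R.
Proof.
apply: complexI; rewrite fro_sqr trmx1 map_mx1 mulmx1 mxtrace1.
by rewrite rmorph_nat.
Qed.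

Variables (Gam : groupType) (Q : seq Gam) (kappa : R).
Hypothesis HT : kazhdan_pair Q kappa.

(** The action T |-> rho(g)^-1 T sigma(g) in the basis of matrix units; it is a
    right action, in agreement with row vectors being multiplied on the right. *)
Lemma unirep_conj n (rho sigma : Gam -> 'M[C]_n) : unirep rho -> unirep sigma ->
  unirep (fun g => lin_mx (mulmxr (sigma g) \o mulmx (rho g^-1%g))).
Proof.
move=> rr rs; split=> [g|g h].
  apply/row_unitarymxP => i j; rewrite !rowE -(vec_mxK (delta_mx 0 i)) -(vec_mxK
    (delta_mx 0 j)).
  rewrite !mul_vec_lin /= dotmx_mxvecE !trmx_mul !map_mxM.
  set A := vec_mx _; set B := vec_mx _.
  rewrite !mulmxA -(mulmxA _ (sigma g)) (unitarymxP (proj1 rs g)) mulmx1 mxtrace_mulC.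
  have -> : (rho g^-1%g)^t* = rho g.
    by rewrite -[LHS]mul1mx -(unirepV g rr) -mulmxA (unitarymxP (proj1 rr _)) mulmx1.
  rewrite !mulmxA unirepV// mul1mx -dotmx_mxvecE !vec_mxK dotmx_sum (bigD1 j)//=.
  rewrite [X in _ + X]big1 ?addr0 => [|k kj]; last first.
    by rewrite !mxE eqxx (negPf kj) conjC0 mulr0.
  by rewrite !mxE !eqxx /= conjC1 mulr1 eq_sym.
apply/row_matrixP => i; rewrite !rowE mulmxA -(vec_mxK (delta_mx 0 i)) !mul_vec_lin /=.
by rewrite invgM (proj2 rs) (proj2 rr) !mulmxA.
Qed.

(** The identity matrix is displaced by fro (rho g - sigma g), and the fixed
    matrices of the conjugation action are the intertwiners. *)
Lemma kazhdan_intertwiner n (rho sigma : Gam -> 'M[C]_n) (eps : R) :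
  unirep rho -> unirep sigma -> 0 <= eps ->
  (forall q, q \in Q -> fro (rho q - sigma q) < kappa * eps) ->
  exists2 T : 'M[C]_n, forall g, rho g *m T = T *m sigma g & fro (1%:M - T) <= eps.
Proof.
move=> rr rs e0 close.
have [q qQ|u Hu ue] := kazhdan_near_fixed (v := mxvec 1%:M) HT e0 (unirep_conj rr rs).
  rewrite mul_vec_lin /= mulmx1 -linearB -[vnorm _]/(fro _).
  rewrite -(fro_mull _ (proj1 rr q)) mulmxBr mulmxA unirepV// mul1mx mulmx1.
  by rewrite froB close.
exists (vec_mx u) => [g|]; last by rewrite /fro linearB /= vec_mxK.
have := Hu g; rewrite -{1}(vec_mxK u) mul_vec_lin /= => /(canRL mxvecK) E.
by rewrite -{1}E !mulmxA unirepV// mul1mx.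
Qed.

Definition irreducible_rep n (rho : Gam -> 'M[C]_n) :=
  unirep rho /\ forall W : 'M[C]_n, (forall g, (W *m rho g <= W)%MS) -> W = 0 \/ row_full W.

(** The kernel of T is invariant under rho. *)
Lemma schur_unit n (rho sigma : Gam -> 'M[C]_n) (T : 'M[C]_n) : irreducible_rep rho ->
  (forall g, rho g *m T = T *m sigma g) -> T != 0 -> T \in unitmx.
Proof.
move=> [rr irr] HTg T0; have [g|K0|Kf] := irr (kermx T).
- by apply/sub_kermxP; rewrite -mulmxA HTg mulmxA mulmx_ker mul0mx.
- by rewrite -row_free_unit -kermx_eq0 K0.
have : (1%:M <= kermx T)%MS by rewrite sub1mx.
by move/sub_kermxP; rewrite mul1mx => T00; rewrite T00 eqxx in T0.
Qed.
End Intertwiners.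

(** * Stability for a family of metric groups *)

Section GenericStability.
Variables (R : realType) (G : metric_family R).
Section Dist.
Variable n : nat.
Implicit Types x y z t : G n.

Lemma fam_distxx x : fam_dist x x = 0. Proof. exact/fam_dist_eq0. Qed.

Lemma fam_dist_ge0 x y : 0 <= fam_dist x y.
Proof.
have := fam_dist_triangle x y x; rewrite fam_distxx (fam_distC y) -mulr2n.
by rewrite pmulrn_lge0.
Qed.

Lemma fam_distM x y z t : fam_dist (x * y)%g (z * t)%g <= fam_dist x z + fam_dist y t.
Proof.
by rewrite (le_trans (fam_dist_triangle _ (z * y)%g _))// fam_distMl fam_distMr.
Qed.

Lemma fam_distV x y : fam_dist x^-1%g y^-1%g = fam_dist x y.
Proof. by rewrite -(fam_distMl x) -(fam_distMr y) mulgV mul1g mulgVK fam_distC. Qed.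

Lemma fam_dist_prod (I : Type) (s : seq I) (f h : I -> G n) :
  fam_dist (\prod_(i <- s) f i)%g (\prod_(i <- s) h i)%g
    <= \sum_(i <- s) fam_dist (f i) (h i).
Proof.
elim: s => [|i s IHs]; first by rewrite !big_nil fam_distxx.
by rewrite !big_cons (le_trans (fam_distM _ _ _ _))// lerD2l.
Qed.

Lemma fam_dist_subst (S : choiceType) (f h : S -> G n) (w : free_group S) :
  fam_dist (word_subst f w) (word_subst h w)
    <= \sum_(x <- fg_word w) fam_dist (f x.1) (h x.1).
Proof.
apply: (le_trans (fam_dist_prod _ _ _)); apply: ler_sum => -[s []] _ //=.
by rewrite fam_distV.
Qed.
End Dist.

Lemma cvg0_le (u v : nat -> R) : (forall k, 0 <= u k) -> (forall k, u k <= v k) ->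
  v k @[k --> \oo] --> 0 -> u k @[k --> \oo] --> 0.
Proof.
move=> u0 uv v0; apply: (squeeze_cvgr _ (cvg_cst 0) v0).
by apply: nearW => k; rewrite u0 uv.
Qed.

Lemma cvg0D (u v : nat -> R) : u k @[k --> \oo] --> 0 -> v k @[k --> \oo] --> 0 ->
  (u k + v k) @[k --> \oo] --> 0.
Proof. by move=> u0 v0; have := cvgD u0 v0; rewrite addr0; apply. Qed.

Lemma cvg0_sum (I : Type) (s : seq I) (u : I -> nat -> R) :
  (forall i, u i k @[k --> \oo] --> 0) -> (\sum_(i <- s) u i k) @[k --> \oo] --> 0.
Proof.
move=> u0; elim: s => [|i s IHs].
  by under eq_fun do rewrite big_nil; exact: cvg_cst.
by under eq_fun do rewrite big_cons; exact: cvg0D.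
Qed.

Definition is_hom (G0 H : groupType) (rho : G0 -> H) := {morph rho : x y / (x * y)%g}.

Lemma is_hom1 (G0 H : groupType) (rho : G0 -> H) : is_hom rho -> rho 1%g = 1%g.
Proof. by move=> hr; apply: (mulgI (rho 1%g)); rewrite -hr !mulg1. Qed.

(** A reduced word is the product of its letters in the free group. *)
Lemma word_subst_pi (S : choiceType) (Gam : groupType)
    (pi : {multiplicative free_group S -> Gam}) (w : free_group S) :
  pi w = word_subst (fun s => pi (@FreeGroup S [:: (s, true)] isT)) w.
Proof.
have pi1 : pi 1%g = 1%g by by apply: is_hom1; exact: gmulfM.
set p := fun s => _; case: w => w; elim: w => [|x w IHw] rw.
  by rewrite /word_subst big_nil -pi1; congr (pi _); apply: val_inj.
have rw' : reduced w by exact: path_sorted rw.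
have -> : FreeGroup rw = (@FreeGroup S [:: x] isT * FreeGroup rw')%g.
  apply: val_inj => /=; case: (w) rw {rw' IHw} => [|y t] //= /andP[/negPf xy _].
  by rewrite xy.
rewrite gmulfM word_substM -IHw; congr (_ * _)%g.
rewrite /word_subst big_seq1; case: x {rw} => s [] //=.
apply: (mulgI (p s)); rewrite mulgV -pi1 -gmulfM; congr (pi _).
by apply: val_inj; rewrite /= /cancels /= eqxx.
Qed.

Variable Gam : groupType.

(** The values of phi on the generators form a stability challenge, since on each
    word the substitution follows phi up to finitely many vanishing errors; the
    solution is extended to Gam through a choice of words. *)
Lemma stable_almost_hom (n : nat -> nat) (phi : forall k, Gam -> G (n k)) : stable G Gam ->
  (forall g h, fam_dist (phi k (g * h)%g) (phi k g * phi k h)%g @[k --> \oo] --> 0) ->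
  exists sigma : forall k, Gam -> G (n k),
    (forall k, is_hom (sigma k)) /\
    forall g, fam_dist (phi k g) (sigma k g) @[k --> \oo] --> 0.
Proof.
move=> [S [pi [pi_surj st]]] phiM.
pose gen s := @FreeGroup S [:: (s, true)] isT.
pose f k s := phi k (pi (gen s)).
have phi1 : fam_dist (phi k 1%g) 1%g @[k --> \oo] --> 0.
  apply: cvg0_le (phiM 1%g 1%g) => k; first exact: fam_dist_ge0.
  by rewrite mulg1 -{2}(mulg1 (phi k 1%g)) fam_distMl fam_distC.
have phiV g : fam_dist (phi k g^-1%g) (phi k g)^-1%g @[k --> \oo] --> 0.
  apply: cvg0_le (cvg0D (phiM g g^-1%g) phi1) => k; first exact: fam_dist_ge0.
  rewrite -(fam_distMl (phi k g)) mulgV.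
  by rewrite (le_trans (fam_dist_triangle _ (phi k 1%g) _))// mulgV (fam_distC _ (phi k
    1%g)).
have fphi (w : free_group S) : fam_dist (word_subst (f k) w) (phi k (pi w)) @[k -->
  \oo] --> 0.
  rewrite word_subst_pi /word_subst; elim: (fg_word w) => [|x s IHs].
    apply: cvg0_le phi1 => k; first exact: fam_dist_ge0.
    by rewrite !big_nil fam_distC.
  set ph := subst_letter _ in IHs *.
  have fx : fam_dist (subst_letter (f k) x) (phi k (ph x)) @[k --> \oo] --> 0.
    case: x => t []; rewrite /ph /subst_letter /=.
      by under eq_fun do rewrite fam_distxx; exact: cvg_cst.
    by under eq_fun do rewrite fam_distC; exact: phiV.
  apply: cvg0_le (cvg0D (cvg0D fx IHs) (phiM (ph x) (\prod_(x <- s) ph x)%g)) => k.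
    exact: fam_dist_ge0.
  rewrite !big_cons (le_trans (fam_dist_triangle _ (phi k (ph x) * phi k (\prod_(x <-
    s) ph x))%g _))//.
  by rewrite lerD ?fam_distM// fam_distC.
have [|g [g1 fg]] := st n f.
  move=> w w1; apply: cvg0_le (cvg0D (fphi w) phi1) => k; first exact: fam_dist_ge0.
  by rewrite w1; exact: fam_dist_triangle.
have [wd wdK] := choice pi_surj.
have pi1 : pi 1%g = 1%g by apply: is_hom1; exact: gmulfM.
have gM k w w' : pi w = pi w' -> word_subst (g k) w = word_subst (g k) w'.
  have E u : pi u = pi w' -> word_subst (g k) (u * w'^-1)%g = 1%g.
    by move=> uw; apply: g1; rewrite gmulfM uw -gmulfM mulgV.
  move=> ww'; apply: (mulIg (word_subst (g k) w'^-1%g)).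
  by rewrite -!word_substM (E w ww') (E w' erefl).
exists (fun k x => word_subst (g k) (wd x)); split.
  by move=> k x y; rewrite -word_substM; apply: gM; rewrite gmulfM !wdK.
move=> x.
have fgs s : fam_dist (f k s) (g k s) @[k --> \oo] --> 0.
  apply: cvg0_le fg => k; first exact: fam_dist_ge0.
  rewrite (bigD1 s)//= lerDl; apply: sumr_ge0 => *; exact: fam_dist_ge0.
apply: cvg0_le (cvg0D (fphi (wd x)) (cvg0_sum (fg_word (wd x)) (fun y => fgs y.1))) => k.
  exact: fam_dist_ge0.
rewrite (le_trans (fam_dist_triangle _ (word_subst (f k) (wd x)) _))//.
by rewrite wdK fam_distC lerD// fam_dist_subst.
Qed.

(** Were sigma_k(g) = 1 for all k, then phi_k(g) would tend to 1. *)
Lemma stable_approximated_hom g : stable G Gam -> approximated G Gam -> g != 1%g ->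
  exists n (rho : Gam -> G n), is_hom rho /\ rho g <> 1%g.
Proof.
move=> st [n [phi [phiM phi_sup]]] g1.
have [sigma [sM sphi]] := stable_almost_hom st phiM.
apply: contrapT => no.
have s1 k : sigma k g = 1%g.
  by apply: contrapT => sg; apply: no; exists (n k), (sigma k).
have := phi_sup g g1.
suff -> : limn_esup (fun k => (fam_dist (phi k g) 1%g)%:E) = 0%E by rewrite ltxx.
apply: (cvg_limn_einf_sup _).2; apply: cvg_EFin; first by apply: nearW.
by apply: cvg_trans (sphi g); under eq_fun do rewrite -(s1 _); apply: cvg_id.
Qed.

Variables (iota : forall n, G n -> G n.+1) (eps : nat -> R).
Hypotheses (iotaM : forall n (x y : G n), iota (x * y)%g = (iota x * iota y)%g)
  (iota_dist : forall n (x y : G n), fam_dist x y <= 2 * fam_dist (iota x) (iota y))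
  (iota_contract : forall n (x y : G n), fam_dist (iota x) (iota y) <= fam_dist x y)
  (iota_approx : forall n (u : G n.+1), exists x, fam_dist (iota x) u <= eps n).

(** iota enlarges a permutation or unitary matrix by a trivial summand.  The
    best approximations of rho(g) by elements iota(x) are asymptotically
    multiplicative in x because iota distorts distances by at most a factor 2. *)
Lemma stable_restrict (n : nat -> nat) (rho : forall k, Gam -> G (n k).+1) :
  stable G Gam -> (forall k, is_hom (rho k)) -> eps (n k) @[k --> \oo] --> 0 ->
  exists sigma : forall k, Gam -> G (n k), (forall k, is_hom (sigma k)) /\
    forall g, fam_dist (iota (sigma k g)) (rho k g) @[k --> \oo] --> 0.
Proof.
move=> st rhoM eps0.
have psiP k g := cid (iota_approx (rho k g)).
pose psi k g := projT1 (psiP k g).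
have Hpsi k g : fam_dist (iota (psi k g)) (rho k g) <= eps (n k) := projT2 (psiP k g).
have eps20 (c : R) : (c * eps (n k)) @[k --> \oo] --> 0.
  by rewrite -(mulr0 c); apply: cvgMr.
have [|sigma [sM sphi]] := @stable_almost_hom n psi st.
  move=> g h; apply: cvg0_le (eps20 6) => k; first exact: fam_dist_ge0.
  rewrite (le_trans (iota_dist _ _))// iotaM (_ : 6 = 2 * 3); last by rewrite -natrM.
  rewrite -mulrA ler_pM2l// (le_trans (fam_dist_triangle _ (rho k (g * h)%g) _))//.
  rewrite (_ : 3 * eps (n k) = eps (n k) + (eps (n k) + eps (n k))); last by ring.
  rewrite lerD// rhoM fam_distC (le_trans (fam_distM _ _ _ _))// lerD//.
exists sigma; split=> // g.
apply: cvg0_le (cvg0D (sphi g) eps0) => k; first exact: fam_dist_ge0.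
rewrite (le_trans (fam_dist_triangle _ (iota (psi k g)) _))// lerD//.
by rewrite fam_distC.
Qed.
End GenericStability.

(** * Intertwiners of permutation actions *)

Section PermRigid.
Variables (R : realType) (Gam : groupType).
Local Notation C := R[i].

Lemma perm_unirep n (rho : Gam -> 'S_n) : is_hom rho ->
  unirep (fun g => perm_mx (rho g) : 'M[C]_n).
Proof.
move=> hr; split=> [g|g h]; last by rewrite hr perm_mxM.
apply/unitarymxP; rewrite tr_perm_mx map_perm_mx -perm_mxM mulgV perm_mx1//.
Qed.

Lemma fro_perm_mx_le n (s t : 'S_n) :
  fro (perm_mx s - perm_mx t : 'M[C]_n) ^+ 2 <= 2 * #|[set x | s x != t x]%SET|%:R.
Proof.
rewrite fro_sqr_sum -sum1_card natr_sum mulr_sumr [leRHS]big_mkcond /=.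
apply: ler_sum => i _; rewrite inE; case: eqVneq => st /=.
  by rewrite big1// => j _; rewrite !mxE st subrr /= expr0n addr0.
have -> : 2 * 1%:R = \sum_j ((s i == j)%:R + (t i == j)%:R) :> R.
  rewrite big_split /= -!natr_sum; under eq_bigr do rewrite eq_sym.
  under [X in _ + X%:R]eq_bigr do rewrite eq_sym.
  rewrite -2!big_mkcond /= !big_pred1_eq; ring.
apply: ler_sum => j _; rewrite !mxE.
by case: eqVneq => _; case: eqVneq => _ /=; rewrite ?(subrr, subr0, sub0r) /=; nra.
Qed.

Definition transitive_hom n (rho : Gam -> 'S_n) := is_hom rho /\
  forall x y, exists g, rho g x = y.

(** By invariance T (rho g x) (sigma g y) = T x y, so that all rows of T agree
    up to a permutation.  On average the rows are near those of the identity,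
    hence every row has exactly one entry with real part above 1/2, in column
    phi x say; phi is equivariant and fixes three quarters of the points.  If phi
    were not injective, then by transitivity every fiber would have two elements,
    and phi would move at least as many points as it fixes.  So phi is an
    isomorphism of actions. *)
Lemma perm_intertwiner_transitive n (rho sigma : Gam -> 'S_n) (T : 'M[C]_n) :
  transitive_hom rho -> is_hom sigma ->
  (forall g, perm_mx (rho g) *m T = T *m perm_mx (sigma g)) ->
  fro (1%:M - T) ^+ 2 <= n%:R / 16 -> transitive_hom sigma.
Proof.
move=> [hr tr] hs HT fT; split=> // y1 y2.
have Tinv g x y : T (rho g x) (sigma g y) = T x y.
  have /matrixP/(_ x (sigma g y)) := HT g.
  by rewrite -row_permE -(invgK (sigma g)) -col_permE !mxE invgK permK.
(* The squared distance of row x of T from that of the identity. *)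
pose err x := \sum_y (complex.Re ((1%:M - T) x y) ^+ 2 + complex.Im ((1%:M - T) x y) ^+ 2).
have err_ge x y : complex.Re ((1%:M - T) x y) ^+ 2 <= err x.
  rewrite /err (bigD1 y)//= -addrA lerDl addr_ge0 ?sqr_ge0//.
  by apply: sumr_ge0 => *; rewrite addr_ge0 ?sqr_ge0.
have sum_err : \sum_x err x <= n%:R / 16 by rewrite -fro_sqr_sum.
have n0 : (0 < n)%N by apply: leq_ltn_trans (ltn_ord y1).
(* A row with at most the average error, whose entries are all within 1/4 of the
  identity. *)
have [x0 ex0] : exists x0, err x0 <= 1 / 16.
  apply: contrapT => /forallNP no; have : \sum_x err x > \sum_(x < n) (1 / 16).
    apply: ltr_sum => [|i _]; first by apply/hasP; exists y1; rewrite ?mem_index_enum.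
    by rewrite ltNge; exact/negP/no.
  by rewrite sumr_const card_ord -[_ *+ n]mulr_natr mulrC mul1r ltNge sum_err.
pose A x y := 1 / 2 < complex.Re (T x y).
have A0 y : A x0 y <-> y = x0.
  have := err_ge x0 y; move: ex0; rewrite /A !mxE raddfB /= eq_sym.
  case: eqVneq => [->|yx] /= h1 h2; split=> //.
  - by move=> _; nra.
  - by move=> h; exfalso; nra.
  - by move=> E; rewrite E eqxx in yx.
have Aall x : exists y, forall z, A x z <-> z = y.
  have [g gx] := tr x0 x; exists (sigma g x0) => z.
  rewrite -gx -(permKV (sigma g) z) /A Tinv -/(A _ _) A0.
  by split=> [->|/perm_inj].
have [phi Aphi] := choice Aall.
have phiE g x : phi (rho g x) = sigma g (phi x).
  by apply/esym/Aphi; rewrite /A Tinv; apply/Aphi.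
pose F := [set x | phi x == x]%SET.
have cF : (4 * #|~: F|%SET <= n)%N.
  have : \sum_(x in ~: F) (1 / 4) <= \sum_x err x.
    rewrite [leRHS](bigID (fun x => x \in ~: F)) /= -[leLHS]addr0.
    apply: lerD; last by apply: sumr_ge0 => i _; apply: le_trans (err_ge i i);
      rewrite sqr_ge0.
    apply: ler_sum => x; rewrite !inE => /eqP nF; have := err_ge x x.
    have : ~ A x x by move/Aphi => E; apply: nF.
    rewrite /A !mxE eqxx raddfB /= => /negP; rewrite -leNgt => h1 h2; nra.
  rewrite sumr_const -[_ *+ _]mulr_natr => h.
  rewrite -(ler_nat R) natrM; lra.
have phi_inj : injective phi.
  move=> x1 x2 E12; apply: contrapT => /eqP n12.
  have Ht x : exists y, y != x /\ phi y = phi x.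
    by have [g <-] := tr x1 x; exists (rho g x2);
      rewrite (inj_eq perm_inj) eq_sym n12 !phiE E12.
  have [t tP] := choice Ht.
  have : (#|F| <= #|~: F|)%N.
    rewrite -(card_in_imset (f := t) (D := mem F)).
      apply: subset_leq_card; apply/fintype.subsetP => _ /imsetP[x + ->].
      by rewrite !inE => /eqP xF; have [tx ->] := tP x; rewrite xF eq_sym.
    move=> x x'; rewrite !inE => /eqP xF /eqP xF' txx'.
    by rewrite -xF -xF' -(tP x).2 -(tP x').2 txx'.
  have := cardsC F; rewrite card_ord; lia.
have [psi _ phiK] := injF_bij phi_inj.
have [g gE] := tr (psi y1) (psi y2); exists g.
by rewrite -[y1]phiK -phiE gE phiK.
Qed.
End PermRigid.

(** * Permutations: deleting a point *)

Section PermEndgame.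
Variables (R : realType).

Lemma lift0_perm_onto n (v : 'S_n.+1) : v 0 = 0 -> exists s : 'S_n, lift0_perm s = v.
Proof.
move=> v0; have Hk k : exists j, v (lift 0 k) = lift 0 j.
  case: (unliftP 0 (v (lift 0 k))) => [j ->|E]; first by exists j.
  by move: E; rewrite -{2}v0 => /perm_inj/eqP; rewrite eq_sym (negPf (neq_lift _ _)).
have [f Hf] := choice Hk.
have f_inj : injective f.
  by move=> i j fij; apply/(@lift_inj _ 0)/(@perm_inj _ v); rewrite !Hf fij.
exists (perm f_inj); apply/permP => i.
case: (unliftP 0 i) => [j ->|->]; last by rewrite lift0_perm0 v0.
by rewrite lift0_perm_lift permE Hf.
Qed.

Lemma hamming_lift0_perm n (s t : 'S_n.+1) :
  hamming_dist R (lift0_perm s) (lift0_perm t) = n.+1%:R / n.+2%:R * hamming_dist R s t.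
Proof.
rewrite /hamming_dist.
transitivity (#|[set x | s x != t x]%SET|%:R / n.+2%:R : R); last first.
  by rewrite [RHS]mulrCA [X in _ = _ * X]mulrAC divff ?pnatr_eq0// mul1r.
congr (_%:R / _).
rewrite -[RHS](card_imset _ (@lift_inj _ 0)); apply: eq_card => x; rewrite inE.
apply/idP/imsetP => [|[j]]; last by rewrite inE => + ->;
  rewrite !lift0_perm_lift (inj_eq (@lift_inj _ _)).
case: (unliftP 0 x) => [j ->|->]; last by rewrite !lift0_perm0 eqxx.
by rewrite !lift0_perm_lift (inj_eq (@lift_inj _ _)) => H; exists j; rewrite ?inE.
Qed.

(** Deleting the point 0 from a permutation u: compose with the transposition of
    u 0 and 0, which alters u in at most two places. *)
Lemma lift0_perm_approx n (u : 'S_n.+2) : exists s : 'S_n.+1,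
  hamming_dist R (lift0_perm s) u <= 2 / n.+2%:R.
Proof.
have [|s sE] := @lift0_perm_onto _ (u * tperm (u 0) 0)%g; first by rewrite permM tpermL.
exists s; rewrite sE -[X in hamming_dist _ _ X](mulg1 u) hamming_distMl /hamming_dist
  ler_pM2r ?invr_gt0 ?ltr0n//.
rewrite ler_nat (@leq_trans #|[set u 0; 0]%SET|)//; last by rewrite cards2; case: (_ == _).
apply/subset_leq_card/fintype.subsetP => x; rewrite !inE perm1.
by apply: contraNT; rewrite negb_or => /andP[x1 x2]; rewrite tpermD// eq_sym.
Qed.

Lemma cvg0_divn (c : R) (n : nat -> nat) : (forall k, (k <= n k)%N) -> 0 <= c ->
  c / (n k).+2%:R @[k --> \oo] --> 0.
Proof.
move=> nk c0; have : (c * harmonic k) @[k --> \oo] --> 0.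
  by rewrite -(mulr0 c); apply: cvgMr; exact: cvg_harmonic.
apply: cvg0_le => k; first by rewrite divr_ge0.
rewrite ler_wpM2l// lef_pV2 ?posrE ?ltr0n// ler_nat ltnS.
exact: leq_trans (nk k) (leqnSn _).
Qed.

Lemma cvg0_uniform (I : eqType) (s : seq I) (u : nat -> I -> R) (c : R) :
  (forall k i, 0 <= u k i) -> (forall i, u k i @[k --> \oo] --> 0) -> 0 < c ->
  exists k, forall i, i \in s -> u k i < c.
Proof.
move=> u0 ucvg c0; have := cvg0_sum s ucvg => /cvgrPdist_lt/(_ c c0)[k _ Hk].
exists k => i si; have := Hk k (leqnn k); rewrite /= sub0r normrN.
apply: le_lt_trans; apply: le_trans (ler_norm _).
by rewrite (big_rem i)//= lerDl; apply: sumr_ge0.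
Qed.

Variable Gam : groupType.

(** The Hamming distance of permutations controls the Frobenius distance of
    their matrices, so that rho and sigma + 1 have an intertwiner close to the
    identity; then sigma + 1 is transitive, although it fixes 0. *)
Lemma kazhdan_perm_not_stable (Q : seq Gam) (kappa : R) : kazhdan_pair Q kappa ->
  (forall N, exists n (rho : Gam -> 'S_n.+1), (N < n)%N /\ transitive_hom rho) ->
  ~ stable (permutation_family R) Gam.
Proof.
move=> HT big st.
have /choice[n Hn] : forall k, exists n, (k <= n)%N /\ exists rho : Gam -> 'S_n.+2,
  transitive_hom rho.
  by move=> k; have [[|n] [rho [kn tr]]] := big k; [|exists n; split; last exists rho].
pose rho k := projT1 (cid (Hn k).2).
have tr k : transitive_hom (rho k) by exact: projT2 (cid (Hn k).2).
have [||||||sigma [sM close]] := @stable_restrict R (permutation_family R) Gam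
  (fun n => @lift0_perm n.+1) (fun n => 2 / n.+2%:R) _ _ _ _ n rho st.
- by move=> m x y; rewrite /lift0_perm lift_permM.
- move=> m x y /=; rewrite hamming_lift0_perm mulrA ler_peMl//;
  first exact: (@fam_dist_ge0 _ (permutation_family R) m).
  rewrite mulrA ler_pdivlMr ?ltr0n// mul1r -natrM ler_nat; lia.
- move=> m x y /=; rewrite hamming_lift0_perm ler_piMl//;
  first exact: (@fam_dist_ge0 _ (permutation_family R) m).
  by rewrite ler_pdivrMr ?ltr0n// mul1r ler_nat.
- by move=> m u /=; exact: lift0_perm_approx.
- by move=> k; case: (tr k).
- by apply: cvg0_divn => // k; case: (Hn k).
have k0 : 0 < kappa by case: HT.
have [||k Hk] := @cvg0_uniform _ Q _ (kappa ^+ 2 / 32) _ close.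
- by move=> k q; exact: fam_dist_ge0.
- by rewrite divr_gt0// exprn_gt0.
(* The tolerance of perm_intertwiner_transitive for degree n k + 2. *)
pose e : R := Num.sqrt ((n k).+2%:R / 16).
have ee : e ^+ 2 = (n k).+2%:R / 16 by rewrite sqr_sqrtr// divr_ge0.
have sM' : is_hom (fun g => lift0_perm (sigma k g)).
  by move=> g h; rewrite sM /lift0_perm lift_permM.
have [|q qQ|T HTg HTe] := kazhdan_intertwiner HT (perm_unirep R (tr k).1) (perm_unirep
  R sM') (eps := e).
- exact: sqrtr_ge0.
- rewrite -(@ltr_pXn2r _ 2)// ?nnegrE ?fro_ge0 ?mulr_ge0 ?sqrtr_ge0 ?ltW//.
  rewrite exprMn ee (le_lt_trans (fro_perm_mx_le _ _ _))//.
  have := Hk q qQ; rewrite /= hamming_distC /hamming_dist ltr_pdivrMr ?ltr0n// => h.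
  lra.
have [|_ tr'] := perm_intertwiner_transitive (tr k) sM' HTg.
  by rewrite -ee ler_pXn2r// ?nnegrE ?fro_ge0 ?sqrtr_ge0.
by have [g] := tr' 0 ord_max; rewrite lift0_perm0 => /eqP.
Qed.
End PermEndgame.

(** * Transitive actions of unbounded degree *)

Section TransitiveUnbounded.
Variables (Gam : groupType).

(** The action on the orbit of x, transported to an initial segment. *)
Lemma orbit_hom n (rho : Gam -> 'S_n) (x : 'I_n) : is_hom rho ->
  exists m (tau : Gam -> 'S_m.+1) (e : 'I_m.+1 -> 'I_n),
    [/\ transitive_hom tau, forall g j, e (tau g j) = rho g (e j) & exists j, e j = x].
Proof.
move=> hr; pose O := [set y | `[<exists g, rho g x = y>]]%SET.
have OP y : reflect (exists g, rho g x = y) (y \in O) by rewrite inE; exact: asboolP.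
have xO : x \in O by apply/OP; exists 1%g; rewrite (is_hom1 hr) perm1.
have stO g y : y \in O -> rho g y \in O.
  by move=> /OP[h <-]; apply/OP; exists (h * g)%g; rewrite hr permM.
have [m Om] : exists m, #|O| = m.+1.
  by case E: #|O| => [|m]; [move: (card0_eq E x); rewrite xO | exists m].
pose e (j : 'I_m.+1) : 'I_n := enum_val (cast_ord (esym Om) j).
(* rk has a junk value outside the orbit. *)
pose rk (y : 'I_n) : 'I_m.+1 := cast_ord Om (enum_rank_in xO y).
have eO j : e j \in O by exact: enum_valP.
have rkK y : y \in O -> e (rk y) = y by move=> yO; rewrite /e /rk cast_ordK enum_rankK_in.
have eK j : rk (e j) = j by rewrite /e /rk enum_valK_in cast_ordKV.
have tinj g : injective (fun j => rk (rho g (e j))).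
  move=> i j /(congr1 e); rewrite !rkK ?stO// => /perm_inj/(congr1 rk).
  by rewrite !eK.
exists m, (fun g => perm (tinj g)), e; split; last by exists (rk x); rewrite rkK.
  split=> [g h|i j].
    by apply/permP => j; rewrite permM !permE hr permM rkK// stO.
  have /OP[g gx] := eO i; have /OP[h hx] := eO j.
  exists (g^-1 * h)%g; apply: (can_inj eK); rewrite permE rkK ?stO// -gx -hx.
  by rewrite -permM -hr mulgA mulgV mul1g.
by move=> g j; rewrite permE rkK// stO.
Qed.

Lemma finite_set_of_injective (U : choiceType) (T : finType) (f : U -> T) :
  injective f -> finite_set [set: U].
Proof.
move=> fi; rewrite -(preimage_setT f); apply: finite_preimage.
  by move=> x y _ _; exact: fi.
exact: finite_finset.
Qed.

(** This is where finite generation enters: the homomorphisms from Gam to a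
    finite group are encoded by finite functions. *)
Lemma hom_determined_finitely : finitely_generated Gam ->
  exists k (a : 'I_k -> Gam), forall (H : groupType) (rho sigma : Gam -> H),
    is_hom rho -> is_hom sigma -> (forall i, rho (a i) = sigma (a i)) -> rho = sigma.
Proof.
move=> [A /finite_seqP[s As] gen]; exists (size s), (tnth (in_tuple s)) => H rho sigma
  hr hs E.
pose P := [pred x | rho x == sigma x].
have hV (tau : Gam -> H) x : is_hom tau -> tau x^-1%g = (tau x)^-1%g.
  by move=> ht; apply: (mulIg (tau x)); rewrite -ht !mulVg (is_hom1 ht).
have Pg : group_closed P.
  split=> [|x y]; first by rewrite inE (is_hom1 hr) (is_hom1 hs).
  by rewrite !inE => /eqP xE /eqP yE; rewrite hr hs !hV// xE yE.
apply/funext => x; apply/eqP; suff : x \in P by []; apply: gen => // y.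
rewrite As /= => ys; have ys' : (index y s < size s)%N by rewrite index_mem.
have := E (Ordinal ys'); rewrite (tnth_nth y) /= nth_index// => yE.
by rewrite /= inE yE.
Qed.

(** Otherwise the values at an element of Gam of the finitely many homomorphisms
    to symmetric groups of degree at most N + 1 would determine the element:
    points are separated by permutation actions, hence by transitive ones, which
    have bounded degree. *)
Lemma transitive_unbounded (N : nat) : finitely_generated Gam ->
  (forall g : Gam, g != 1%g -> exists n (rho : Gam -> 'S_n.+1), is_hom rho /\ rho g <>
    1%g) ->
  ~ finite_set [set: Gam] ->
  exists n (rho : Gam -> 'S_n.+1), (N < n)%N /\ transitive_hom rho.
Proof.
move=> /hom_determined_finitely[k [a agen]] det inf; apply: contrapT => no; apply: inf.
pose good m (t : {ffun 'I_k -> 'S_m.+1}) (rho : Gam -> 'S_m.+1) := is_hom rho /\ forall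
  i, rho (a i) = t i.
pose h m (t : {ffun 'I_k -> 'S_m.+1}) : Gam -> 'S_m.+1 :=
  if pselect (exists rho, good m t rho) is left ex then projT1 (cid ex) else fun=> 1%g.
have hE m (tau : Gam -> 'S_m.+1) : is_hom tau -> h m [ffun i => tau (a i)] = tau.
  move=> ht; rewrite /h; case: pselect => [ex|[]]; last by exists tau; split=> // i;
    rewrite ffunE.
  have [hr E] := projT2 (cid ex); apply: agen => // i.
  by rewrite E ffunE.
pose Phi g : {dffun forall m : 'I_N.+1, {ffun {ffun 'I_k -> 'S_m.+1} -> 'S_m.+1}} :=
  [ffun m : 'I_N.+1 => [ffun t => h m t g]].
apply: (@finite_set_of_injective _ _ Phi) => x y Pxy; apply: contrapT => /eqP nxy.
have [|n [rho [hr rxy]]] := det (x * y^-1)%g; first by rewrite divg_eq1.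
have [i ri] : exists i, rho x i <> rho y i.
  apply: contrapT => /forallNP E; apply: rxy.
  have xy : rho x = rho y by apply/permP => i; apply: contrapT; exact: E.
  by rewrite hr xy -hr mulgV (is_hom1 hr).
have [m [tau [e [tt et [j ej]]]]] := orbit_hom i hr.
have mN : (m < N.+1)%N.
  by rewrite ltnS leqNgt; apply/negP => Nm; apply: no; exists m, tau.
move/ffunP: Pxy => /(_ (Ordinal mN)); rewrite !ffunE => /ffunP/(_ [ffun i => tau (a i)]).
rewrite !ffunE /= !hE; last exact: tt.1. 
move=> E; apply: ri; by rewrite -ej -!et E.
Qed.
End TransitiveUnbounded.

(** * Matrix coefficients *)

Lemma infinite_uniq_seq (T : choiceType) : ~ finite_set [set: T] ->
  forall n, exists s : seq T, uniq s /\ size s = n.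
Proof.
move=> inf; elim=> [|n [s [us sn]]]; first by exists [::].
have [x xs] : exists x, x \notin s.
  apply: contrapT => /forallNP all_s; apply: inf; apply: sub_finite_set (finite_seq s).
  by move=> x _ /=; apply: contrapT => /negP; exact: all_s.
by exists (x :: s); rewrite /= xs us sn.
Qed.

Section Irreps.
Variables (R : realType) (Gam : groupType).
Local Notation C := R[i].

(** The span of the matrix coefficients of finite-dimensional unitary
    representations.  Tensor products make it an algebra. *)
Inductive coefficient : (Gam -> C) -> Prop :=
| coefficient_entry d (rho : Gam -> 'M[C]_d) i j :
    unirep rho -> coefficient (fun g => rho g i j)
| coefficientD f h : coefficient f -> coefficient h -> coefficient (fun g => f g + h g)
| coefficientZ c f : coefficient f -> coefficient (fun g => c * f g).

Lemma unirep_tens m n (rho : Gam -> 'M[C]_m) (sigma : Gam -> 'M[C]_n) :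
  unirep rho -> unirep sigma -> unirep (fun g => rho g *t sigma g).
Proof.
move=> [ru rM] [su sM]; split=> [g|g h]; last by rewrite rM sM tensmx_mul.
apply/unitarymxP; rewrite trmx_tens map_mxT tensmx_mul.
rewrite (unitarymxP (ru g)) (unitarymxP (su g)); apply/matrixP => i j.
case: (mxtens_indexP i) => i0 k; case: (mxtens_indexP j) => j0 l.
rewrite tensmxE !mxE (inj_eq (can_inj (@mxtens_indexK _ _))) xpair_eqE /=.
by rewrite -natrM mulnb.
Qed.

Lemma coefficientM f h : coefficient f -> coefficient h -> coefficient (fun g => f g * h g).
Proof.
move=> cf ch; elim: cf => {f} [m rho i j rr|f1 f2 _ IH1 _ IH2|c f _ IH].
- elim: ch => {h} [n sigma k l rs|h1 h2 _ IH1 _ IH2|c h _ IH].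
  + have -> : (fun g => rho g i j * sigma g k l) =
      fun g => (rho g *t sigma g) (mxtens_index (i, k)) (mxtens_index (j, l)).
      by apply/funext => g; rewrite tensmxE.
    by apply: (coefficient_entry (rho := fun g => rho g *t sigma g)); exact: unirep_tens.
  + by under eq_fun do rewrite mulrDr; exact: coefficientD.
  + by under eq_fun do rewrite mulrCA; exact: coefficientZ.
- by under eq_fun do rewrite mulrDl; exact: coefficientD.
- by under eq_fun do rewrite -mulrA; exact: coefficientZ.
Qed.

Lemma coefficient_cst c : coefficient (fun=> c).
Proof.
have r1 : unirep (fun _ : Gam => 1%:M : 'M[C]_1).
  by split=> [g|g h]; [apply/unitarymxP; rewrite trmx1 map_mx1 mulmx1|rewrite mulmx1].
have := coefficientZ c (coefficient_entry 0 0 r1).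
by under eq_fun do rewrite mxE eqxx mulr1.
Qed.

Hypothesis sep : forall g : Gam, g != 1%g ->
  exists n (rho : Gam -> 'M[C]_n), unirep rho /\ rho g <> 1%:M.

Lemma coefficient_separate x y : x != y ->
  exists f, [/\ coefficient f, f x = 1 & f y = 0].
Proof.
move=> xy; have [|n [rho [rr rxy]]] := sep (g := (x * y^-1)%g); first by rewrite divg_eq1.
have [i [j rij]] : exists i j, rho x i j - rho y i j != 0.
  apply: contrapT => no; apply: rxy; rewrite (proj2 rr) (_ : rho x = rho y) ?unirepV//.
  apply/matrixP => i j; apply/eqP; rewrite -subr_eq0; apply: contrapT => /negP ij.
  by apply: no; exists i, j.
exists (fun g => (rho x i j - rho y i j)^-1 * (rho g i j + - rho y i j)); split.
- apply: coefficientZ; apply: coefficientD; last exact: coefficient_cst.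
  exact: coefficient_entry.
- by rewrite mulVf.
- by rewrite subrr mulr0.
Qed.

(** The product of the functions separating x from each element of s. *)
Lemma coefficient_interpolate x (s : seq Gam) : x \notin s ->
  exists f, [/\ coefficient f, f x = 1 & forall y, y \in s -> f y = 0].
Proof.
elim: s => [|y s IHs] => [_|]; first by exists (fun=> 1); split=> //;
  exact: coefficient_cst.
rewrite inE negb_or => /andP[xy /IHs[f [cf fx fs]]].
have [h [ch hx hy]] := coefficient_separate xy.
exists (fun g => f g * h g); split; [exact: coefficientM|by rewrite fx hx mulr1|].
by move=> z; rewrite inE => /predU1P[->|/fs ->]; rewrite ?hy ?mulr0 ?mul0r.
Qed.

Definition inspan (I : finType) (e : I -> Gam -> C) (f : Gam -> C) :=
  exists c : I -> C, forall g, f g = \sum_i c i * e i g.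

Section Span.
Variables (I : finType) (e : I -> Gam -> C).

Lemma inspan_base i : inspan e (e i).
Proof.
exists (fun j => (j == i)%:R) => g; rewrite (bigD1 i)//= eqxx mul1r big1 ?addr0//.
by move=> j /negPf ->; rewrite mul0r.
Qed.

Lemma inspanD f h : inspan e f -> inspan e h -> inspan e (fun g => f g + h g).
Proof.
move=> [c cE] [d dE]; exists (fun i => c i + d i) => g.
by rewrite cE dE -big_split; apply: eq_bigr => i _; rewrite mulrDl.
Qed.

Lemma inspanZ a f : inspan e f -> inspan e (fun g => a * f g).
Proof.
move=> [c cE]; exists (fun i => a * c i) => g.
by rewrite cE mulr_sumr; apply: eq_bigr => i _; rewrite mulrA.
Qed.

Lemma inspan_sum (J : Type) (s : seq J) (f : J -> Gam -> C) :
  (forall j, inspan e (f j)) -> inspan e (fun g => \sum_(j <- s) f j g).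
Proof.
move=> fe; elim: s => [|j s IHs].
  by exists (fun=> 0) => g; rewrite big_nil big1// => i _; rewrite mul0r.
by under eq_fun do rewrite big_cons; exact: inspanD.
Qed.

Lemma inspan_mulmx m n p q (A : 'M[C]_(m, n)) (M : Gam -> 'M[C]_(n, p)) (B : 'M[C]_(p,
  q)) i j :
  (forall k l, inspan e (fun g => M g k l)) -> inspan e (fun g => (A *m M g *m B) i j).
Proof.
move=> Me; under eq_fun do rewrite mxE; apply: inspan_sum => k.
under eq_fun do rewrite mulrC; apply: inspanZ.
by under eq_fun do rewrite mxE; apply: inspan_sum => l; exact: inspanZ.
Qed.

(** Interpolation at n points provides n linearly independent coefficients. *)
Lemma span_finite : (forall f, coefficient f -> inspan e f) -> finite_set [set: Gam].
Proof.
move=> ce; apply: contrapT => inf; pose K := #|I|.+1.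
have [s [us sK]] := infinite_uniq_seq inf K.
pose p (i : 'I_K) := nth 1%g s i.
have pinj : injective p.
  by move=> i j /eqP; rewrite nth_uniq ?sK// => /eqP/val_inj.
have /choice[f Hf] (i : 'I_K) : exists f, coefficient f /\ forall j : 'I_K, f (p j) =
  (i == j)%:R.
  have [|f [cf fi fps]] := @coefficient_interpolate (p i) [seq p j | j <- enum 'I_K & j
    != i].
    apply/negP => /mapP[j]; rewrite mem_filter => /andP[ji _] /pinj E.
    by rewrite E eqxx in ji.
  exists f; split=> // j; case: eqVneq => [<-|ij]; first exact: fi.
  by apply: fps; apply/mapP; exists j => //; rewrite mem_filter eq_sym ij mem_enum.
have /choice[c cE] i := ce _ (Hf i).1.
have : (\matrix_(i < K, l < #|I|) c i (enum_val l)) *m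
   (\matrix_(l < #|I|, j < K) e (enum_val l) (p j)) = 1%:M.
  apply/matrixP => i j; rewrite !mxE -(Hf i).2 cE.
  rewrite (reindex _ (onW_bij _ (enum_val_bij I))) /=.
  by apply: eq_bigr => l _; rewrite !mxE.
by move/mulmx1_min; rewrite /K ltnn.
Qed.
End Span.
End Irreps.

(** * Irreducible representations of unbounded dimension *)

Section IrrepsUnbounded.
Variables (R : realType) (Gam : groupType).
Local Notation C := R[i].

Lemma unitarymx_coord_le1 n (U : 'M[C]_n) i j : U \is unitarymx -> `|U i j| <= 1.
Proof.
move=> /unitarymxP/matrixP/(_ i i); rewrite !mxE eqxx mulr1n => E.
rewrite -(@expr_le1 _ 2)// -E (bigD1 j)//= !mxE -normCK lerDl.
by apply: sumr_ge0 => k _; rewrite !mxE -normCK exprn_ge0.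
Qed.

Lemma unitarymx_part_le1 n (U : 'M[C]_n) i j (b : bool) : U \is unitarymx ->
  `|(if b then complex.Re (U i j) else complex.Im (U i j))| <= 1.
Proof.
move=> /(unitarymx_coord_le1 i j); set z := U i j => z1.
have : complex.Re z ^+ 2 + complex.Im z ^+ 2 <= 1.
  by rewrite -lecR add_Re2_Im2 exprn_ile1.
move=> h; rewrite -(@expr_le1 _ 2)// real_normK ?num_real//.
by case: b; apply: le_trans h; rewrite ?lerDl ?lerDr sqr_ge0.
Qed.

(** A cover of [-1, 1] by finitely many intervals of length delta. *)
Lemma grid_key (delta : R) : 0 < delta -> exists K (key : R -> 'I_K.+1), forall x y,
  `|x| <= 1 -> `|y| <= 1 -> key x = key y -> `|x - y| <= delta.
Proof.
move=> d0; pose K := Num.truncn (2 / delta).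
exists K, (fun x => inord (Num.truncn ((x + 1) / delta))).
have bd (x : R) : `|x| <= 1 -> 0 <= (x + 1) / delta /\ (Num.truncn ((x + 1) / delta) <
  K.+1)%N.
  rewrite ler_norml => /andP[x1 x2]; have x0 : 0 <= (x + 1) / delta.
    by apply: divr_ge0; [lra|exact: ltW].
  split=> //; rewrite ltnS; apply: le_truncn; rewrite ler_pM2r ?invr_gt0//; lra.
move=> x y /bd[x0 xK] /bd[y0 yK] /(congr1 val); rewrite /= !inordK// => E.
have /andP[x1 x2] := truncn_itv x0; have /andP[y1 y2] := truncn_itv y0.
rewrite E in x1 x2; rewrite -[_.+1%:R]natr1 in x2 y2.
have : `|(x + 1) / delta - (y + 1) / delta| <= 1.
  move: x1 x2 y1 y2; move: (Num.truncn _)%:R => N; set X := (x + 1) / delta;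
    set Y := (y + 1) / delta.
  by move=> *; rewrite ler_norml; apply/andP; split; lra.
by rewrite -mulrBl normrM normfV (gtr0_norm d0) ler_pdivrMr// mul1r opprD addrACA subrr
  addr0.
Qed.

Variables (Q : seq Gam) (kappa : R).
Hypothesis HT : kazhdan_pair Q kappa.

(** Total boundedness: discretizing the entries of the matrices rho(q), for q in
    Q, sorts the representations of dimension d into finitely many classes within
    which they are close on Q. *)
Lemma irreducible_key d : exists (T : finType) (key : (Gam -> 'M[C]_d) -> T),
  forall rho sigma, irreducible_rep rho -> irreducible_rep sigma -> key rho = key sigma ->
  forall q, q \in Q -> fro (rho q - sigma q) < kappa * (1 / 2).
Proof.
have k0 : 0 < kappa by case: HT.
(* Then 2 * d ^ 2 * delta ^ 2 < (kappa / 2) ^ 2, there being 2 * d ^ 2 real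
   coordinates. *)
pose delta := kappa / 4 / d.+1%:R.
have d0 : 0 < delta by rewrite !divr_gt0.
have [K [key Hkey]] := grid_key d0.
pose part (b : bool) (z : C) := if b then complex.Re z else complex.Im z.
exists {ffun 'I_(size Q) * 'I_d * 'I_d * bool -> 'I_K.+1},
  (fun rho : Gam -> 'M[C]_d => [ffun x : 'I_(size Q) * 'I_d * 'I_d * bool => key (part
    x.2 (rho (nth 1%g Q x.1.1.1) x.1.1.2 x.1.2))]).
move=> rho sigma [rr _] [rs _] /ffunP E q qQ.
have iq : (index q Q < size Q)%N by rewrite index_mem.
have close i j b : `|part b (rho q i j) - part b (sigma q i j)| <= delta.
  apply: Hkey.
  - exact: unitarymx_part_le1 (proj1 rr q).
  - exact: unitarymx_part_le1 (proj1 rs q).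
  have := E (Ordinal iq, i, j, b); rewrite !ffunE /= nth_index//.
rewrite -(@ltr_pXn2r _ 2)// ?nnegrE ?fro_ge0 ?mulr_ge0 ?ltW// fro_sqr_sum.
apply: (@le_lt_trans _ _ (\sum_(i < d) \sum_(j < d) (delta ^+ 2 + delta ^+ 2))).
  apply: ler_sum => i _; apply: ler_sum => j _; rewrite !mxE !raddfB /=.
  have sq b : (part b (rho q i j) - part b (sigma q i j)) ^+ 2 <= delta ^+ 2.
    rewrite -(real_normK (num_real (_ - _))) ler_pXn2r ?nnegrE ?(ltW d0)//; exact: close.
  exact: lerD (sq true) (sq false).
rewrite !sumr_const !card_ord -mulrnA -[_ *+ (d * d)]mulr_natr natrM /delta.
have e0 : 0 < d.+1%:R :> R by [].
have -> : (d%:R : R) = d.+1%:R - 1 by rewrite -natr1 addrK.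
move: e0; set e : R := d.+1%:R => e0.
have e1 : 1 <= e by rewrite /e ler1n.
have -> : ((kappa / 4 / e) ^+ 2 + (kappa / 4 / e) ^+ 2) * ((e - 1) * (e - 1)) =
  kappa ^+ 2 / 8 * ((e - 1) / e) ^+ 2 by field; rewrite gt_eqF.
have r0 : 0 <= (e - 1) / e by apply: divr_ge0; lra.
have r1 : (e - 1) / e <= 1 by rewrite ler_pdivrMr// mul1r; lra.
move: r0 r1; set r := (e - 1) / e => r0 r1; have r2 : r ^+ 2 <= 1 by nra.
have := ler_wpM2l (sqr_ge0 kappa) r2; have := exprn_gt0 2 k0; lra.
Qed.

(** One representation is selected in each class; any other irreducible
    representation of the class is conjugate to it by Property (T) and Schur's
    lemma, hence its entries are combinations of the selected ones. *)
Lemma irreducible_span D : exists (I : finType) (e : I -> Gam -> C),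
  forall d (rho : Gam -> 'M[C]_d), (d <= D)%N -> irreducible_rep rho ->
  forall i j, inspan e (fun g => rho g i j).
Proof.
pose keyT d := projT1 (cid (irreducible_key d)).
pose key d : (Gam -> 'M[C]_d) -> keyT d := projT1 (cid (projT2 (cid (irreducible_key d)))).
have keyP d := projT2 (cid (projT2 (cid (irreducible_key d)))).
pose good d t (rho : Gam -> 'M[C]_d) := irreducible_rep rho /\ key d rho = t.
pose rep d t : Gam -> 'M[C]_d :=
  if pselect (exists rho, good d t rho) is left ex then projT1 (cid ex) else fun=> 0.
exists {d : 'I_D.+1 & (keyT d * 'I_d * 'I_d)%type},
  (fun (x : {d : 'I_D.+1 & (keyT d * 'I_d * 'I_d)%type}) g => rep (tag x) (tagged
    x).1.1 g (tagged x).1.2 (tagged x).2).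
move=> d rho dD irr i j.
set e := (X in inspan X).
have repP : good d (key d rho) (rep d (key d rho)).
  rewrite /rep; case: pselect => [ex|[]]; first exact: projT2 (cid ex).
  by exists rho.
set sigma := rep _ _ in repP.
have sspan k l : inspan e (fun g => sigma g k l).
  have dD' : (d < D.+1)%N by [].
  exact: (inspan_base e (Tagged (fun d : 'I_D.+1 => (keyT d * 'I_d * 'I_d)%type)
    (i := Ordinal dD') (key d rho, k, l))).
have d0 : (0 < d)%N by apply: leq_ltn_trans (ltn_ord i).
have [||T HTg fT] := kazhdan_intertwiner HT irr.1 repP.1.1 (eps := 1 / 2).
- by rewrite divr_ge0.
- by apply: keyP => //; [exact: repP.1|exact: (esym repP.2)].
have T0 : T != 0.
  apply: contraTneq fT => ->; rewrite subr0 -ltNge -(@ltr_pXn2r _ 2)// ?nnegrE ?fro_ge0//.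
  have d1 : 1 <= d%:R :> R by rewrite ler1n.
  by rewrite fro_sqr1; nra.
have Tu := schur_unit irr HTg T0.
have -> : (fun g => rho g i j) = fun g => (T *m sigma g *m invmx T) i j.
  by apply/funext => g; rewrite -HTg mulmxK.
exact: inspan_mulmx.
Qed.

Section Decompose.
Variables (I : finType) (e : I -> Gam -> C).
Hypothesis irr_span : forall d (rho : Gam -> 'M[C]_d), irreducible_rep rho ->
  forall i j, inspan e (fun g => rho g i j).

(** Complete reducibility, by induction on the dimension: if W is a proper
    invariant subspace, then rho is the sum of its parts on W and on the
    orthogonal complement of W. *)
Lemma unirep_span d (rho : Gam -> 'M[C]_d) : unirep rho ->
  forall i j, inspan e (fun g => rho g i j).
Proof.
have [m] := ubnP d; elim: m d rho => // m IH d rho dm rr i j.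
have [irr|red] := pselect (irreducible_rep rho); first exact: irr_span.
have [W [stW W0 Wf]] : exists W : 'M_d, [/\ forall g, (W *m rho g <= W)%MS, W <> 0 & ~~
  row_full W].
  apply: contrapT => no; apply: red; split=> // W stW.
  have [->|/eqP W0] := eqVneq W 0; first by left.
  by right; apply: contrapT => /negP Wf; apply: no; exists W.
pose W' := orthomx Num.conj 1%:M W.
pose B1 := orthobasis W; pose B2 := orthobasis W'.
have B1u : B1 \is unitarymx by exact: orthobasis_unitary.
have B2u : B2 \is unitarymx by exact: orthobasis_unitary.
have st1 g : (B1 *m rho g <= B1)%MS.
  by rewrite orthobasis_eqmx (submx_trans _ (stW g))// submxMr// orthobasis_eqmx.
have st2 g : (B2 *m rho g <= B2)%MS.
  by rewrite orthobasis_eqmx (submx_trans _ (orthomx_stable rr stW g))// submxMr//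
    orthobasis_eqmx.
have B21 : B2 *m B1^t* = 0.
  apply/orthomx1P; rewrite orthobasis_eqmx; apply/orthomx1P.
  have /submxP[X ->] : (B1 <= W)%MS by rewrite orthobasis_eqmx.
  have /orthomx1P W'W : (W' <= W')%MS by [].
  by rewrite trmx_mul map_mxM mulmxA W'W mul0mx.
have B12 : B1 *m B2^t* = 0.
  have := congr1 (fun X => X^t*) B21; rewrite trmx_mul map_mxM trmxCK => ->.
  by apply/matrixP => k l; rewrite !mxE conjC0.
have one : B1^t* *m B1 + B2^t* *m B2 = 1%:M.
  have /sub_addsmxP[[X Y] /= E] : (1%:M <= B1 + B2)%MS.
    by rewrite (adds_eqmx (orthobasis_eqmx W) (orthobasis_eqmx W')) addsmx_ortho submx1.
  rewrite -[LHS]mul1mx [in LHS]E mulmxDl !mulmxDr -!mulmxA.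
  rewrite !(mulmxA B1) !(mulmxA B2) (unitarymxP B1u) (unitarymxP B2u) B12 B21.
  by rewrite !mul0mx !mulmx0 addr0 add0r !mul1mx -E.
have -> : (fun g => rho g i j) = fun g =>
    (B1^t* *m subrep B1 rho g *m B1) i j + (B2^t* *m subrep B2 rho g *m B2) i j.
  apply/funext => g; rewrite -!(mulmxA (_^t*)) !subrepE// !mulmxA.
  by rewrite -[rho g in LHS]mul1mx -one mulmxDl mxE.
have rk1 : (\rank W < m)%N.
  have : (\rank W < d)%N by rewrite ltn_neqAle Wf rank_leq_col.
  lia.
have rk2 : (\rank W' < m)%N.
  rewrite rank_ortho; apply: (@leq_trans d); last by rewrite -ltnS.
  rewrite ltn_subrL lt0n mxrank_eq0 (leq_ltn_trans _ (ltn_ord i))// andbT.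
  exact/eqP.
by apply: inspanD; apply: inspan_mulmx; apply: IH => //; exact: subrep_unirep.
Qed.
End Decompose.

Lemma irreducible_unbounded : ~ finite_set [set: Gam] ->
  (forall g : Gam, g != 1%g -> exists n (rho : Gam -> 'M[C]_n), unirep rho /\ rho g <>
    1%:M) ->
  forall N, exists d (rho : Gam -> 'M[C]_d), (N < d)%N /\ irreducible_rep rho.
Proof.
move=> inf sep N; apply: contrapT => no; apply: inf.
have le_N d (rho : Gam -> 'M[C]_d) : irreducible_rep rho -> (d <= N)%N.
  by move=> irr; rewrite leqNgt; apply/negP => Nd; apply: no; exists d, rho.
have [I [e He]] := irreducible_span N.
have irr_span d (rho : Gam -> 'M[C]_d) : irreducible_rep rho ->
    forall i j, inspan e (fun g => rho g i j).
  by move=> irr; apply: He => //; exact: le_N irr.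
apply: (span_finite sep (e := e)) => f; elim=> [d rho i j rr|f1 f2 _ ? _ ?|c f1 _ ?].
- exact: unirep_span.
- exact: inspanD.
- exact: inspanZ.
Qed.
End IrrepsUnbounded.

(** * Unitary matrices: deleting a dimension *)

Section UnitaryEndgame.
Variables (R : realType).
Local Notation C := R[i].

Lemma hs_norm_fro n (T : 'M[C]_n.+1) : hs_norm T = fro T / Num.sqrt n.+1%:R.
Proof.
rewrite /hs_norm mxtrace_mulC -fro_sqr /= sqrtrM ?invr_ge0// sqrtr_sqr ger0_norm ?fro_ge0//.
by rewrite mulrC sqrtrV.
Qed.

Definition block1 n (A : 'M[C]_n) : 'M[C]_(1 + n) := block_mx 1%:M 0 0 A.

Lemma block1M n (A B : 'M[C]_n) : block1 A *m block1 B = block1 (A *m B).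
Proof. by rewrite /block1 mulmx_block !mulmx1 !mulmx0 !mul0mx !addr0 add0r. Qed.

Lemma block1_adj n (A : 'M[C]_n) : (block1 A)^t* = block1 (A^t*).
Proof.
rewrite /block1 tr_block_mx map_block_mx !trmx0 trmx1 map_mx1.
by congr block_mx; apply/matrixP => i j; rewrite !mxE conjC0.
Qed.

Lemma block1_unitary n (A : 'M[C]_n) : (block1 A \is unitarymx) = (A \is unitarymx).
Proof.
have b1 : block1 (1%:M : 'M[C]_n) = 1%:M by rewrite /block1 -scalar_mx_block.
apply/unitarymxP/unitarymxP; rewrite block1_adj block1M; last by move->.
by rewrite -b1 => /eq_block_mx[].
Qed.

Lemma fro_block1 n (A B : 'M[C]_n) : fro (block1 A - block1 B) = fro (A - B).
Proof.
have -> : block1 A - block1 B = block_mx 0 0 0 (A - B) :> 'M[C]_(1 + n).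
  by rewrite /block1 opp_block_mx add_block_mx !subrr.
apply/eqP; rewrite -(@eqrXn2 _ 2) ?fro_ge0//; apply/eqP/complexI; rewrite !fro_sqr.
rewrite tr_block_mx map_block_mx !trmx0 mulmx_block.
by rewrite mxtrace_block !mul0mx !addr0 mxtrace0 !add0r.
Qed.

Lemma block1_fix0 n (A : 'M[C]_n) :
  delta_mx 0 0 *m block1 A = delta_mx 0 0 :> 'rV_(1 + n).
Proof.
have -> : delta_mx 0 0 = row_mx 1%:M 0 :> 'rV[C]_(1 + n).
  apply/rowP => j; rewrite !mxE; case: splitP => i /= ji; rewrite !mxE -val_eqE /= ji.
    by rewrite ord1.
  by [].
rewrite /block1; apply: (etrans (mul_row_block (1%:M : 'M[C]_1) 0 1%:M 0 0 A)).
by rewrite mulmx1 !mulmx0 !mul0mx !addr0.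
Qed.

(** The complex reflection in the direction w = y - e which takes y to e.  Its
    coefficient is the inverse of a = <y, w> and not 2 / <w, w>, which would only
    do for real <y, e>; unitarity amounts to <w, w> = a + a^*.  When a = 0 this
    gives w = 0, and the formula still holds with the convention 0^-1 = 0. *)
Lemma unitary_reflection n (y e : 'rV[C]_n) : dotmx y y = 1 -> dotmx e e = 1 ->
  exists F : 'M[C]_n, [/\ F \is unitarymx, y *m F = e & fro (F - 1%:M) <= 2].
Proof.
move=> y1 e1; pose w := y - e; pose a := dotmx y w.
have aE : a = 1 - dotmx y e by rewrite /a /w linearBr /= y1.
have eyE : dotmx e y = 1 - a^*.
  by rewrite (hermC (@dotmx C n)) /= expr0 mul1r aE rmorphB /= conjC1 subKr.
have wwE : dotmx w w = a + a^*.
  rewrite {1}/w linearBl /= -/a; suff -> : dotmx e w = - a^* by rewrite opprK.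
  by rewrite /w linearBr /= eyE e1 addrAC subrr add0r.
pose F := 1%:M - a^-1 *: (w^t* *m w); exists F.
have sc1 (M : 'M[C]_1) : M = (M 0 0)%:M by exact: mx11_scalar.
have ww : w *m w^t* = (a + a^*)%:M by rewrite -wwE dotmxE -sc1.
have yw : y *m w^t* = a%:M by rewrite /a dotmxE -sc1.
have Fadj : F^t* = 1%:M - a^-1^* *: (w^t* *m w).
  by rewrite /F linearB /= linearZ /= trmx1 trmx_mul map_mxB map_mx1 map_mxZ map_mxM trmxCK.
have [a0|a0] := eqVneq a 0.
  have w0 : w = 0.
    apply/eqP; rewrite -vnorm_eq0 -sqrf_eq0 -(inj_eq (@complexI _)) vnorm_sqr.
    by rewrite wwE a0 conjC0 addr0.
  have F1 : F = 1%:M by rewrite /F a0 invr0 scale0r subr0.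
  rewrite F1 mulmx1 subrr fro0; split=> //; first by apply/unitarymxP;
    rewrite trmx1 map_mx1 mulmx1.
  by apply/eqP; rewrite -subr_eq0 -/w w0.
have ac0 : a^* != 0 by rewrite conjC_eq0.
pose P := w^t* *m w.
have PP : P *m P = (a + a^*) *: P.
  by rewrite /P mulmxA -(mulmxA (w^t*)) ww mul_mx_scalar -scalemxAl.
have xV : (a^-1)^* = (a^*)^-1 by rewrite fmorphV.
split.
- apply/unitarymxP; rewrite Fadj /F -/P mulmxBl !mulmxBr !mulmx1 mul1mx -scalemxAl
  -scalemxAr PP.
  rewrite !scalerA xV (_ : _ * _ = a^-1 + (a^*)^-1); last by field; rewrite a0 ac0.
  by rewrite scalerDl opprB (addrC (a^-1 *: P)) addrK subrK.
- rewrite /F mulmxBr mulmx1 -scalemxAr mulmxA yw mul_scalar_mx scalerA mulVf// scale1r.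
  by rewrite /w opprB addrC subrK.
rewrite /F addrAC subrr add0r froN.
rewrite -(@ler_pXn2r _ 2)// ?nnegrE ?fro_ge0//.
rewrite -lecR fro_sqr.
have Padj : (a^-1 *: P)^t* = (a^-1)^* *: P.
  by rewrite linearZ /= trmx_mul map_mxZ map_mxM trmxCK.
rewrite -/P Padj -scalemxAl -scalemxAr PP !scalerA linearZ /= [\tr P]mxtrace_mulC ww.
rewrite mxtrace_scalar mulr1n -(mulrA (a^-1 * _)) xV -invfM.
have -> : (a + a^*) * (a + a^*) = `|a + a^*| ^+ 2.
  by rewrite normCK rmorphD /= conjCK [a^* + a]addrC.
rewrite -normCK mulrC ler_pdivrMr ?exprn_gt0 ?normr_gt0//.
have two : (2 : R)%:C%C = 2 :> C by rewrite -[2 in LHS]/(1 + 1) rmorphD.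
rewrite rmorphXn /= two -exprMn ler_pXn2r ?nnegrE ?mulr_ge0//.
by rewrite (le_trans (ler_normD _ _))// norm_conjC -mulr2n mulr_natl.
Qed.

(** A unitary matrix with first row e_0 also has first column e_0. *)
Lemma unitary_fix_corner n (V : 'M[C]_(1 + n)) : V \is unitarymx ->
  delta_mx 0 0 *m V = (delta_mx 0 0 : 'rV_(1 + n)) -> V = block1 (drsubmx V).
Proof.
move=> Vu Ve; set e := delta_mx 0 0 in Ve.
have Ve' : V *m e^t* = e^t*.
  by rewrite -{1}Ve trmx_mul map_mxM mulmxA (unitarymxP Vu) mul1mx.
have Vrow k : V 0 k = (k == 0)%:R.
  by have /matrixP/(_ 0 k) := Ve; rewrite -rowE !mxE.
have Vcol k : V k 0 = (k == 0)%:R.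
  have eE : e^t* = delta_mx 0 0 by rewrite trmx_delta map_delta_mx.
  by have /matrixP/(_ k 0) := Ve'; rewrite eE -colE !mxE andbT.
have l0 : lshift n 0 = 0 :> 'I_(1 + n) by exact: val_inj.
by rewrite -{1}[V]submxK /block1; congr block_mx; apply/matrixP => i j;
  rewrite !ord1 !mxE l0 ?Vrow ?Vcol.
Qed.

Lemma hs_dist_fro n (A B : unitary_group R n.+1) :
  hs_dist A B = fro (unitary_mx A - unitary_mx B) / Num.sqrt n.+1%:R.
Proof. exact: hs_norm_fro. Qed.

Fact block1_subproof n (A : unitary_group R n) :
  block1 (unitary_mx A) \is unitarymx.
Proof. by rewrite block1_unitary; exact: valP A. Qed.

Definition unitary_block1 n (A : unitary_group R n) : unitary_group R n.+1 :=
  Unitary (block1_subproof A).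

Lemma unitary_block1M n (A B : unitary_group R n) :
  unitary_block1 (A * B)%g = (unitary_block1 A * unitary_block1 B)%g.
Proof. by apply: val_inj; rewrite /= block1M. Qed.

Lemma hs_dist_block1 n (A B : unitary_group R n.+1) :
  hs_dist (unitary_block1 A) (unitary_block1 B) =
  fro (unitary_mx A - unitary_mx B) / Num.sqrt n.+2%:R.
Proof. by rewrite hs_dist_fro /= fro_block1. Qed.

(** Deleting a dimension: correct U by the reflection taking its first row to
    e_0.  The Frobenius norm of the correction is at most 2 in any dimension. *)
Lemma unitary_block1_approx n (U : unitary_group R n.+2) : exists A : unitary_group R n.+1,
  hs_dist (unitary_block1 A) U <= Num.sqrt (4 / n.+2%:R).
Proof.
have Uu : unitary_mx U \is unitarymx by exact: valP U.
pose e : 'rV[C]_n.+2 := delta_mx 0 0.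
have e1 : dotmx e e = 1.
  rewrite dotmx_sum (bigD1 0)//= big1 ?addr0 ?mxE ?eqxx ?conjC1 ?mulr1// => k k0.
  by rewrite mxE (negPf k0) andbF mul0r.
have [|F [Fu Fe F2]] := @unitary_reflection _ (e *m unitary_mx U) e _ e1.
  by rewrite dotmx_unitary.
pose V := unitary_mx U *m F.
have Vu : V \is unitarymx by exact: mul_unitarymx.
have VE : V = block1 (drsubmx (V : 'M_(1 + n.+1))).
  by apply: unitary_fix_corner => //; rewrite /V mulmxA.
have Au : drsubmx (V : 'M_(1 + n.+1)) \is unitarymx by rewrite -block1_unitary -VE.
exists (Unitary Au); rewrite hs_dist_fro /= -VE /V.
have -> : unitary_mx U *m F - unitary_mx U = unitary_mx U *m (F - 1%:M).
  by rewrite mulmxBr mulmx1.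
rewrite fro_mull// sqrtrM// sqrtrV// ler_pM2r ?invr_gt0 ?sqrtr_gt0//.
by rewrite (le_trans F2)// (_ : 4 = 2 ^+ 2) ?sqrtr_sqr ?ger0_norm// -natrX.
Qed.

Variable Gam : groupType.

Lemma unitary_hom_unirep n (rho : Gam -> unitary_group R n) : is_hom rho ->
  unirep (fun g => unitary_mx (rho g)).
Proof. by move=> hr; split=> [g|g h]; [exact: valP (rho g)|rewrite hr]. Qed.

(** The intertwiner T between rho and 1 + sigma is invertible by Schur's lemma, so
    the fixed vector e_0 of 1 + sigma is carried to a fixed vector of rho. *)
Lemma kazhdan_unitary_not_stable (Q : seq Gam) (kappa : R) : kazhdan_pair Q kappa ->
  (forall N, exists d (rho : Gam -> 'M[C]_d), (N < d)%N /\ irreducible_rep rho) ->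
  ~ stable (unitary_family R) Gam.
Proof.
move=> HT big st.
have /choice[n Hn] : forall k, exists n, (k <= n)%N /\
    exists rho : Gam -> 'M[C]_n.+2, irreducible_rep rho.
  by move=> k; have [[|[|n]] [rho [kn irr]]] := big k.+1 => //; exists n; split;
    last exists rho.
pose rho k := projT1 (cid (Hn k).2).
have irr k : irreducible_rep (rho k) by exact: projT2 (cid (Hn k).2).
pose urho k g : unitary_group R (n k).+2 := Unitary (proj1 (irr k).1 g).
have hs_ge0 m (x y : unitary_group R m.+1) : 0 <= hs_dist x y.
  exact: (@fam_dist_ge0 _ (unitary_family R) m).
have [||||||sigma [sM close]] := @stable_restrict R (unitary_family R) Gam
  (fun n => @unitary_block1 n.+1) (fun n => Num.sqrt (4 / n.+2%:R)) _ _ _ _ n urho st.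
- by move=> m x y; exact: unitary_block1M.
- move=> m x y /=; rewrite hs_dist_block1 hs_dist_fro mulrCA ler_wpM2l ?fro_ge0//.
  rewrite ler_pdivlMr ?sqrtr_gt0// mulrC ler_pdivrMr ?sqrtr_gt0//.
  rewrite -(@ler_pXn2r _ 2)// ?nnegrE ?mulr_ge0 ?sqrtr_ge0// exprMn !sqr_sqrtr//.
  rewrite -natrX -natrM ler_nat; lia.
- move=> m x y /=; rewrite hs_dist_block1 hs_dist_fro ler_wpM2l ?fro_ge0//.
  by rewrite lef_pV2 ?posrE ?sqrtr_gt0// ler_wsqrtr// ler_nat.
- by move=> m u; exact: unitary_block1_approx.
- by move=> k g h; apply: val_inj; exact: (proj2 (irr k).1).
- rewrite -(sqrtr0 R); apply: continuous_cvg; first exact: sqrt_continuous.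
  by apply: cvg0_divn => // k; case: (Hn k).
have k0 : 0 < kappa by case: HT.
have [||k Hk] := @cvg0_uniform _ _ Q _ (kappa / 2) _ close.
- by move=> k q; exact: fam_dist_ge0.
- by rewrite divr_gt0.
have sM' : is_hom (fun g => unitary_block1 (sigma k g)).
  by move=> g h; rewrite sM unitary_block1M.
set N := (n k).+2; have sN : 0 < Num.sqrt N%:R :> R by rewrite sqrtr_gt0.
have rs := unitary_hom_unirep sM'.
have [||T HTg fT] := kazhdan_intertwiner HT (irr k).1 rs (eps := Num.sqrt N%:R / 2).
- by rewrite divr_ge0 ?sqrtr_ge0.
- move=> q /Hk; rewrite /= hs_dist_fro ltr_pdivrMr// froB => /lt_le_trans; apply.
  by rewrite mulrAC mulrA.
(* The norm of the identity is sqrt N, twice the tolerance. *)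
have T0 : T != 0.
  apply: contraTneq fT => ->; rewrite subr0 -ltNge.
  have -> : fro (1%:M : 'M[C]_N) = Num.sqrt N%:R.
    by rewrite -fro_sqr1 sqrtr_sqr ger0_norm ?fro_ge0.
  lra.
have Tu := schur_unit (irr k) HTg T0.
pose e : 'rV[C]_N := delta_mx 0 0.
have esig g : e *m unitary_mx (unitary_block1 (sigma k g)) = e by exact: block1_fix0.
pose w := e *m invmx T.
have wT : w *m T = e by rewrite /w mulmxKV.
have wfix g : w *m rho k g = w.
  by apply: (can_inj (mulmxK Tu)); rewrite -mulmxA HTg mulmxA wT esig.
have [g|/eqP|] := (irr k).2 <<w>>%MS.
- by rewrite !genmxE (eqmxMr _ (genmxE w)) wfix.
- rewrite -submx0 genmxE submx0 => /eqP w0; move: wT;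
  rewrite w0 mul0mx => /matrixP/(_ 0 0)/eqP.
  by rewrite !mxE eqxx eq_sym oner_eq0.
- by rewrite -col_leq_rank mxrank_gen => /leq_trans/(_ (rank_leq_row w)).
Qed.
End UnitaryEndgame.

(** * Infinite groups with Property (T) are not stable *)

Theorem theorem1p3 (R : realType) (Gam : groupType) :
  finitely_generated Gam ->
  (sofic R Gam -> property_T R Gam -> ~ finite_set [set: Gam] ->
     ~ stable (permutation_family R) Gam) /\
  (hyperlinear R Gam -> property_T R Gam -> ~ finite_set [set: Gam] ->
     ~ stable (unitary_family R) Gam).
Proof.
move=> fg; split=> appr /property_T_kazhdan_pair[Q [kappa HT]] inf st.
- apply: (kazhdan_perm_not_stable HT _ st) => N.
  by apply: transitive_unbounded => // g; exact: stable_approximated_hom st appr.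
apply: (kazhdan_unitary_not_stable HT _ st).
apply: (irreducible_unbounded HT inf) => g g1.
have [n [rho [hr rg]]] := stable_approximated_hom st appr g1.
exists n.+1, (fun x => unitary_mx (rho x)); split; first exact: unitary_hom_unirep.
by move=> E; apply: rg; apply: val_inj.
Qed.
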